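(* Let $p>1$, $g\in GL_N$ and assume $\lim_{\rho\to0}\operatorname{ess\,inf}_{r<\rho}Env\,\Psi_g(r)>2$. There exists a singular solution to $(1)_p$ provided $$\int_0^{R}\mathcal M_g^{p-1}(r)\,Env\,\Theta_g(r)\,r^{2p-1}\,dr<\infty.$$
   Context: $N\ge1$, $B_r\subset\mathbb{R}^N$ is the open ball of radius $r>0$ centered at the origin. The data are given on a ball $B_{R_0}$, $R_0>0$: let $\mathscr{L}u=\sum_{i,j=1}^N a_{ij}(x)\frac{\partial^2u}{\partial x_i\partial x_j}+\sum_{i=1}^N b_i(x)\frac{\partial u}{\partial x_i}$, where $\mathbf a=(a_{ij})\in L^\infty(B_{R_0})$ is a.e. symmetric and there is $\nu>1$ with $\nu^{-1}|\xi|^2\le\sum_{i,j}a_{ij}(x)\xi_i\xi_j\le\nu|\xi|^2$ for all $\xi\in\mathbb{R}^N$ and a.a. $x\in B_{R_0}\setminus\{0\}$; $\mathbf b=(b_i)\in L^\infty_{\rm loc}(B_{R_0}\setminus\{0\})$ satisfies $|b_i(x)|\le c/|x|$ for a.a. $x\in B_{R_0}\setminus\{0\}$, $1\le i\le N$, for some $c>0$. The weight satisfies $K\in L^\infty_{\rm loc}(B_{R_0}\setminus\{0\})$, $\operatorname{ess\,inf}K>0$. The number $R>0$ is fixed so small that $\overline{B_R}\subset g(B_{R_0})$. For $p\in\mathbb{R}$, $(1)_p$ denotes the inequality $\mathscr{L}u\ge K(x)u^p$ a.e. in a punctured ball. A solution to $(1)_p$ is a function $u>0$ for which there is some (small) radius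 $R'\in(0,R_0]$ such that $u\in W^{2,N}(B_{R'}\setminus\overline B_\varepsilon)$ for all $\varepsilon\in(0,R')$ and $\mathscr{L}u\ge Ku^p$ a.e. on $B_{R'}\setminus\{0\}$. It is a singular solution if $\limsup_{|x|\to0}u(x)=\infty$. Envelope: for measurable $f$, $Env\,f(r):=\lim_{\delta\to0}\operatorname{ess\,sup}_{||x|-r|<\delta}f(x)$. For $g\in GL_N$ let $\mathbf a_g(x):=g\,\mathbf a(g^{-1}x)\,g^\top$, $\mathbf b_g(x):=g\,\mathbf b(g^{-1}x)$ and $$\Psi_g(x):=\frac{\operatorname{Tr}\mathbf a_g(x)+\mathbf b_g(x)\cdot x}{(\mathbf a_g(x)x,x)/|x|^2},\qquad \Theta_g(x):=\frac{K(g^{-1}x)}{(\mathbf a_g(x)x,x)/|x|^2},\qquad \mathcal M_g(r):=\exp\Big\{\int_r^R Env\,\Psi_g(\tau)\frac{d\tau}\tau\Big\}.$$ *)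

(* Defs.v *)
From HB Require Import structures.
From mathcomp Require Import all_boot all_order all_algebra.
From mathcomp Require Import all_classical all_reals all_analysis.
From mathcomp Require Import measurable_realfun ess_sup_inf.

Set Implicit Arguments.
Unset Strict Implicit.
Unset Printing Implicit Defensive.

Import Order.TTheory GRing.Theory Num.Theory.
Import numFieldNormedType.Exports.

Local Open Scope classical_set_scope.
Local Open Scope ring_scope.

(* R^n is 'cV[R]_n, with the sigma-algebra generated by the coordinates (that
   is, the Borel one). *)
Section cV_measurable.
Variables (R : realType) (n : nat).

Definition cV_coord (i : 'I_n) (x : 'cV[R]_n) : R := x i 0.

Let cV_set0 : g_sigma_preimage cV_coord set0.
Proof. exact: sigma_algebra0. Qed.

Let cV_setC A : g_sigma_preimage cV_coord A -> g_sigma_preimage cV_coord (~` A).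
Proof. exact: sigma_algebraC. Qed.

Let cV_bigcup (F : _^nat) : (forall i, g_sigma_preimage cV_coord (F i)) ->
  g_sigma_preimage cV_coord (\bigcup_i (F i)).
Proof. exact: sigma_algebra_bigcup. Qed.

HB.instance Definition _ := @isMeasurable.Build default_measure_display
  'cV[R]_n (g_sigma_preimage cV_coord) cV_set0 cV_setC cV_bigcup.

Lemma measurable_cV_coord (i : 'I_n) : measurable_fun [set: 'cV[R]_n] (cV_coord i).
Proof.
move=> _ Y mY; rewrite setTI; apply: sub_sigma_algebra => /=.
rewrite -bigcup_seq/=; exists i => /=; first by rewrite mem_index_enum.
by exists Y => //; rewrite setTI.
Qed.

Lemma measurable_fun_cVP d (T : measurableType d) (f : T -> 'cV[R]_n) :
  (forall i, measurable_fun [set: T] (cV_coord i \o f)) ->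
  measurable_fun [set: T] f.
Proof.
move=> mf _ A mA; rewrite setTI.
have : preimage_set_system [set: T] f (g_sigma_preimage cV_coord) (f @^-1` A).
  by exists A => //; rewrite setTI.
rewrite -g_sigma_preimage_comp; apply: smallest_sub => /=.
  exact: sigma_algebra_measurable.
rewrite -bigcup_seq => X [i _] [Y mY <-].
exact: mf.
Qed.

End cV_measurable.

(* Lebesgue measure on R^n, by induction on n: the image of the product of the
   Lebesgue measures of R and R^n under (x, y) |-> col_mx x y. *)
Section lebesgue_step.
Variables (R : realType) (n : nat).

Definition cV_cons (z : R * 'cV[R]_n) : 'cV[R]_n.+1 := col_mx z.1%:M z.2.

Definition cV_uncons (x : 'cV[R]_n.+1) : R * 'cV[R]_n :=
  (x ord0 0, \col_i x (lift ord0 i) 0).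

Lemma cV_cons0 z : cV_cons z ord0 0 = z.1.
Proof.
have -> : ord0 = @lshift 1 n ord0 by exact/val_inj.
by apply: (etrans (col_mxEu _ _ _ _)); rewrite mxE eqxx mulr1n.
Qed.

Lemma cV_consS z i : cV_cons z (lift ord0 i) 0 = z.2 i 0.
Proof.
have -> : lift ord0 i = rshift 1 i by exact/val_inj.
exact: col_mxEd.
Qed.

Lemma cV_consK : cancel cV_cons cV_uncons.
Proof.
move=> [x y]; congr (_, _); first exact: cV_cons0.
by apply/colP => i; rewrite mxE cV_consS.
Qed.

Lemma cV_unconsK : cancel cV_uncons cV_cons.
Proof.
move=> x; apply/colP => i; case: (unliftP ord0 i) => [j ->|->].
  by rewrite cV_consS mxE.
by rewrite cV_cons0.
Qed.

Lemma measurable_cV_cons : measurable_fun [set: R * 'cV[R]_n] cV_cons.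
Proof.
apply: measurable_fun_cVP => i; case: (unliftP ord0 i) => [j ->|->].
  rewrite (_ : _ \o _ = @cV_coord R n j \o snd); last first.
    by apply/funext => z; rewrite /cV_coord /= cV_consS.
  by apply: measurableT_comp => //; exact: measurable_cV_coord.
rewrite (_ : _ \o _ = fst)//.
by apply/funext => z; rewrite /cV_coord /= cV_cons0.
Qed.

Lemma measurable_cV_uncons : measurable_fun [set: 'cV[R]_n.+1] cV_uncons.
Proof.
apply: measurable_fun_pair => /=; first exact: (@measurable_cV_coord R n.+1 ord0).
apply: measurable_fun_cVP => i.
rewrite (_ : _ \o _ = @cV_coord R n.+1 (lift ord0 i)).
  exact: measurable_cV_coord.
by apply/funext => x; rewrite /cV_coord /= mxE.
Qed.

Variable m : {sigma_finite_measure set 'cV[R]_n -> \bar R}.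

Definition lebesgue_cons : set 'cV[R]_n.+1 -> \bar R :=
  pushforward (@lebesgue_measure R \x m)%E cV_cons.

Let lebesgue_cons0 : lebesgue_cons set0 = 0%E.
Proof. by rewrite /lebesgue_cons /pushforward preimage_set0 measure0. Qed.

Let lebesgue_cons_ge0 A : (0 <= lebesgue_cons A)%E.
Proof. exact: (measure_ge0 (@lebesgue_measure R \x m)%E). Qed.

Let lebesgue_cons_sigma_additive : semi_sigma_additive lebesgue_cons.
Proof.
move=> F mF tF mUF; rewrite /lebesgue_cons /pushforward preimage_bigcup.
apply: measure_semi_sigma_additive.
- by move=> k; rewrite -[X in measurable X]setTI; exact: measurable_cV_cons.
- apply/trivIsetP => /= i j _ _ ij; rewrite -preimage_setI.
  by move/trivIsetP : tF => /(_ _ _ _ _ ij) ->//; rewrite preimage_set0.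
- rewrite -preimage_bigcup -[X in measurable X]setTI.
  exact: measurable_cV_cons.
Qed.

HB.instance Definition _ := isMeasure.Build _ _ _ lebesgue_cons
  lebesgue_cons0 lebesgue_cons_ge0 lebesgue_cons_sigma_additive.

Let lebesgue_cons_sigma_finite : sigma_finite setT lebesgue_cons.
Proof.
have /sigma_finiteP[F [TF ndF Foo]] := sigma_finiteT (@lebesgue_measure R).
have /sigma_finiteP[G [TG ndG Goo]] := sigma_finiteT m.
exists (fun k => cV_uncons @^-1` (F k `*` G k)).
  rewrite -preimage_bigcup (_ : \bigcup_i _ = setT) ?preimage_setT//.
  apply/seteqP; split => // -[x y] _.
  have [k _ Fkx] : (\bigcup_i F i) x by rewrite -TF.
  have [l _ Gly] : (\bigcup_i G i) y by rewrite -TG.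
  exists (maxn k l) => //; split => /=.
  - by move: Fkx; exact/subsetPset/ndF/leq_maxl.
  - by move: Gly; exact/subsetPset/ndG/leq_maxr.
move=> k; have [mFk Fkoo] := Foo k; have [mGk Gkoo] := Goo k; split.
  rewrite -[X in measurable X]setTI; apply: measurable_cV_uncons => //.
  exact: measurableX.
rewrite /lebesgue_cons /pushforward -comp_preimage.
rewrite (_ : _ \o _ = id); last by apply/funext => z /=; rewrite cV_consK.
rewrite preimage_id product_measure1E// lte_mul_pinfty//.
by rewrite ge0_fin_numE.
Qed.

HB.instance Definition _ := Measure_isSigmaFinite.Build _ _ _ lebesgue_cons
  lebesgue_cons_sigma_finite.

End lebesgue_step.

Fixpoint lebesgue (R : realType) (n : nat) :
    {sigma_finite_measure set 'cV[R]_n -> \bar R} :=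
  if n is n'.+1 then lebesgue_cons (lebesgue R n') else \d_(0 : 'cV[R]_0).

Section lebesgue_spaces.
Variables (R : realType) (n : nat).
Local Notation vec := 'cV[R]_n.
Local Notation mu := (lebesgue R n).

(* Lebesgue measurability: measurability for the completion of mu. For such
   functions the integrals and norms below, computed with Borel simple
   functions, are the usual ones. *)
Definition lebesgue_measurable (D : set vec) (f : vec -> R) :=
  forall Y, measurable Y -> completed_algebra_gen mu (D `&` f @^-1` Y).

Definition in_Lp (q : \bar R) (D : set vec) (f : vec -> R) :=
  lebesgue_measurable D f /\ finite_norm mu q (f \_ D).

Definition in_Lp_loc (q : \bar R) (D : set vec) (f : vec -> R) :=
  forall C : set vec, compact C -> C `<=` D -> in_Lp q C f.

(* Iterated partial derivative along the coordinates listed in s. *)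
Definition pderiv (s : seq 'I_n) (phi : vec -> R) : vec -> R :=
  foldr (fun i f => 'D_(delta_mx i 0) f) phi s.

Definition test_function (D : set vec) (phi : vec -> R) :=
  (forall s x, differentiable (pderiv s phi) x) /\
  (exists C : set vec, [/\ compact C, C `<=` D &
    forall x, ~ C x -> phi x = 0]).

Definition weak_deriv (D : set vec) (s : seq 'I_n) (u v : vec -> R) :=
  [/\ in_Lp_loc 1%E D u, in_Lp_loc 1%E D v &
    forall phi, test_function D phi ->
      \int[mu]_(x in D) (u x * pderiv s phi x) =
      (-1) ^+ size s * \int[mu]_(x in D) (v x * phi x)].

Definition sobolev (k : nat) (q : \bar R) (D : set vec) (u : vec -> R) :=
  in_Lp q D u /\
  forall s : seq 'I_n, (size s <= k)%N ->
    exists2 v, in_Lp q D v & weak_deriv D s u v.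

End lebesgue_spaces.

Definition ess_sup_on d (T : measurableType d) (R : realType)
    (mu : {measure set T -> \bar R}) (D : set T) (f : T -> \bar R) : \bar R :=
  ess_sup mu (patch (fun=> -oo%E) D f).

Definition ess_inf_on d (T : measurableType d) (R : realType)
    (mu : {measure set T -> \bar R}) (D : set T) (f : T -> \bar R) : \bar R :=
  ess_inf mu (patch (fun=> +oo%E) D f).

Section elliptic_inequality.
Variables (R : realType) (n : nat).
Local Notation vec := 'cV[R]_n.
Local Notation mu := (lebesgue R n).

Definition dot (x y : vec) : R := \sum_i x i 0 * y i 0.

(* The library norm of 'cV[R]_n is the sup norm. *)
Definition enorm (x : vec) : R := Num.sqrt (dot x x).

Definition eball (r : R) : set vec := [set x | enorm x < r].

Definition punctured_eball (r : R) : set vec := eball r `\ 0.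

Definition annulus (e r : R) : set vec := [set x | e < enorm x < r].

(* du and d2u stand for the first and second order derivatives of u. *)
Definition elliptic_op (a : vec -> 'M[R]_n) (b : vec -> vec)
    (du : 'I_n -> vec -> R) (d2u : 'I_n -> 'I_n -> vec -> R) (x : vec) : R :=
  \sum_i \sum_j a x i j * d2u i j x + \sum_i b x i 0 * du i x.

(* A function that is W^{2,n} on annuli has a continuous representative; u is
   this representative, so that its pointwise values are meaningful. The weak
   derivatives are unique up to null sets. *)
Definition solution (R0 : R) (a : vec -> 'M[R]_n) (b : vec -> vec)
    (K : vec -> R) (p : R) (u : vec -> R) :=
  exists r : R, [/\ 0 < r <= R0,
    forall x, punctured_eball r x -> 0 < u x /\ {for x, continuous u},
    forall e, 0 < e < r -> sobolev 2 n%:R%:E (annulus e r) u &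
    exists du d2u, [/\
      forall i, weak_deriv (punctured_eball r) [:: i] u (du i),
      forall i j, weak_deriv (punctured_eball r) [:: i; j] u (d2u i j) &
      \forall x \ae mu, punctured_eball r x ->
        K x * u x `^ p <= elliptic_op a b du d2u x]].

Definition singular (u : vec -> R) :=
  limf_esup (EFin \o u) (0 : vec)^' = +oo%E.

Definition env (f : vec -> R) (r : R) : \bar R :=
  lim (ess_sup_on mu [set x | `|enorm x - r| < delta] (EFin \o f)
    @[delta --> 0^'+]).

Definition conj_a (g : 'M[R]_n) (a : vec -> 'M[R]_n) (x : vec) : 'M[R]_n :=
  g *m a (invmx g *m x) *m g^T.

Definition conj_b (g : 'M[R]_n) (b : vec -> vec) (x : vec) : vec :=
  g *m b (invmx g *m x).

Definition radial_coef (g : 'M[R]_n) (a : vec -> 'M[R]_n) (x : vec) : R :=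
  dot (conj_a g a x *m x) x / enorm x ^+ 2.

Definition Psi (g : 'M[R]_n) (a : vec -> 'M[R]_n) (b : vec -> vec) (x : vec) : R :=
  (\tr (conj_a g a x) + dot (conj_b g b x) x) / radial_coef g a x.

Definition Theta (g : 'M[R]_n) (a : vec -> 'M[R]_n) (K : vec -> R) (x : vec) : R :=
  K (invmx g *m x) / radial_coef g a x.

Definition growth (g : 'M[R]_n) (a : vec -> 'M[R]_n) (b : vec -> vec)
    (R1 r : R) : \bar R :=
  expeR (\int[lebesgue_measure]_(t in `]r, R1[) (env (Psi g a b) t * (t^-1)%:E))%E.

End elliptic_inequality.

(* Main.v *)
Require Import Defs.
From mathcomp Require Import all_boot all_order all_algebra.
From mathcomp Require Import all_classical all_reals all_analysis.
From mathcomp Require Import measurable_realfun ess_sup_inf.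
From mathcomp Require Import ring lra.

(** The singular solution is u(x) = U(s) with s = |g x| and U a decreasing
function that blows up at 0. Put A(y) = (a_g(y) y, y) / |y|^2 and write
U'(r) = - r G(r). The chain rule gives

  L u (x) = A(g x) (- s G'(s) - G(s) Psi_g(g x))       (elliptic_op_radial),

while K(x) = A(g x) Theta_g(g x). Almost everywhere Psi_g(y) and Theta_g(y) are
at most their envelopes E and T at |y| (le_env_ae), and G > 0; so it is enough
to solve the ordinary differential inequality

  T U^p <= - r G' - G E   near 0.

If E and T were continuous, this could be done explicitly. Let
M(r) = exp (int_r E / tau), so that r M' = - E M, and try G = M W with a
correction W with values in [1, 2]. Then - r G' - G E = - r M W'. As E >= 2 + eps
near 0, the function M r^2 is nonincreasing and (2 / eps) M r^2 decreases faster
than U does, so that U <= (2 / eps) M r^2. Hence the inequality holds as soon as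
- W' = C T M^(p-1) r^(2p-1) with C = (2 / eps)^p, and such a W stays in [1, 2]
on a small interval because the right-hand side is integrable at 0: this is the
integral condition. Finally r G >= M r is at least a positive multiple of 1 / r,
whence U is at least a positive multiple of log (1 / r) and u is singular
(radial_subsolution).

The envelopes are only upper semicontinuous. Instead of working with an
absolutely continuous G, they are replaced by continuous majorants F of E and t'
of T, so close to them that the integrals of (F - E) / r and of
(t' - T) M^(p-1) r^(2p-1) are at most 1 (usc_approximation). The first bound
makes the factor M built from F at most a multiple of the growth factor built
from E (integral_growth_lb), so that the integral condition passes to F and t'
(radial_profile). Upper semicontinuity also turns the hypothesis on the limit of
the essential infima of E into a lower bound at every point near 0
(lim_ess_inf_gt).

With F and t' continuous, G is continuously differentiable and u has continuous
second derivatives off the origin. Classical derivatives are weak derivatives by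
an integration by parts, and they are bounded on annuli (sobolev_smooth,
radial_fun_sobolev). The statements that hold almost everywhere in y = g x are
pulled back to x because invertible linear maps preserve null sets (ae_mulmx). *)

Set Implicit Arguments.
Unset Strict Implicit.
Unset Printing Implicit Defensive.

Import Order.TTheory GRing.Theory Num.Theory.
Import numFieldNormedType.Exports.

Local Open Scope classical_set_scope.
Local Open Scope ring_scope.

(** * Lebesgue measure under translations and linear maps *)

Section cV_measurable_maps.
Variables (R : realType).

Lemma measurable_fun_cV_coordP d (T : measurableType d) n (f : T -> 'cV[R]_n) :
  (forall i, measurable_fun [set: T] (fun t => f t i 0)) ->
  measurable_fun [set: T] f.
Proof. by move=> mf; apply: measurable_fun_cVP => i; exact: mf. Qed.

Lemma measurable_cV_entry n (i : 'I_n) (D : set 'cV[R]_n) :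
  measurable_fun D (fun x : 'cV[R]_n => x i 0).
Proof. by apply: measurable_funTS; exact: measurable_cV_coord. Qed.

Lemma measurable_cV_add d (T : measurableType d) n (f h : T -> 'cV[R]_n) :
  measurable_fun setT f -> measurable_fun setT h ->
  measurable_fun setT (fun t => f t + h t).
Proof.
move=> mf mh; apply: measurable_fun_cV_coordP => i.
under eq_fun do rewrite mxE.
apply: measurable_funD.
- exact: (measurableT_comp (@measurable_cV_entry n i setT) mf).
- exact: (measurableT_comp (@measurable_cV_entry n i setT) mh).
Qed.

Lemma measurable_cV_shift n (v : 'cV[R]_n) :
  measurable_fun setT (fun x : 'cV[R]_n => x + v).
Proof.
exact: (@measurable_cV_add _ _ n id (fun=> v)).
Qed.

Lemma measurable_cV_mulmx m n (M : 'M[R]_(m, n)) :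
  measurable_fun setT (fun x : 'cV[R]_n => M *m x).
Proof.
apply: measurable_fun_cV_coordP => i.
under eq_fun do rewrite mxE.
apply: measurable_sum => j.
apply: measurable_funM => //.
exact: measurable_cV_entry.
Qed.

End cV_measurable_maps.

Section translation_invariance.
Variables (R : realType).

Lemma lebesgue_measure_shift (c : R) (A : set (measurableTypeR R)) :
  measurable A ->
  lebesgue_measure ((fun x : R => x + c) @^-1` A) = lebesgue_measure A.
Proof.
move=> mA.
have mf : measurable_fun setT
   ((fun x : R => x + c) : measurableTypeR R -> measurableTypeR R).
  by apply: measurable_funD.
pose m' := (pushforward (@lebesgue_measure R) (fun x : R => x + c : measurableTypeR R)).
apply/esym; rewrite (@lebesgue_measure_unique _ m')//.
move=> _ [[a b]] _ <-.
have pE : (fun x : R => x + c) @^-1` `]a, b]%classic = `]a - c, b - c]%classic.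
  by apply/seteqP; split => x /=; rewrite !in_itv/= ltrBlDr lerBrDr.
transitivity (lebesgue_measure (`]a - c, b - c]%classic : set R)); last first.
  by rewrite -pE.
rewrite !lebesgue_measure_itv/= !lte_fin ltrD2r.
by case: ifPn => // _; rewrite -!EFinB; congr EFin; ring.
Qed.

(** Translation acts separately on the first coordinate and on the others, so the
induction on the dimension rests on the uniqueness of product measures. *)
Lemma lebesgue_shift n (v : 'cV[R]_n) (A : set 'cV[R]_n) : measurable A ->
  lebesgue R n ((fun x => x + v) @^-1` A) = lebesgue R n A.
Proof.
elim: n v A => [|n IH] v A mA.
  by congr (lebesgue R 0 _); apply/seteqP; split => x /=; rewrite [x + v]flatmx0 [x]flatmx0.
pose v0 := v ord0 0; pose v1 := (cV_uncons v).2.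
pose T (z : R * 'cV[R]_n) : measurableTypeR R * 'cV[R]_n := (z.1 + v0, z.2 + v1).
have mT : measurable_fun setT (T : measurableTypeR R * 'cV[R]_n -> _).
  apply: measurable_fun_pair => /=.
    by apply: measurable_funD.
  exact: (measurableT_comp (measurable_cV_shift _) measurable_snd).
pose m' := (pushforward (@lebesgue_measure R \x lebesgue R n)%E T).
have mcA : measurable (@cV_cons R n @^-1` A).
  by rewrite -[X in measurable X]setTI; exact: measurable_cV_cons.
transitivity (m' (@cV_cons R n @^-1` A)).
  rewrite /m' /pushforward/= /lebesgue_cons /pushforward/=.
  congr (product_measure1 _ _ _); apply/seteqP; split => -[x y] /=;
  (rewrite (_ : cV_cons (T (x,y)) = cV_cons (x,y) + v)//;
   apply/colP => i; rewrite [in RHS]mxE;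
   case: (unliftP ord0 i) => [j ->|->];
   by rewrite ?cV_consS ?cV_cons0 ?mxE).
apply/esym; rewrite [LHS]/= /lebesgue_cons {1}/pushforward.
apply: (@product_measure_unique _ _ _ _ _ (@lebesgue_measure R) (lebesgue R n) m') => // B C mB mC.
transitivity ((@lebesgue_measure R \x lebesgue R n)%E
  (((fun x : R => x + v0) @^-1` B) `*` ((fun x => x + v1) @^-1` C))); first by [].
rewrite product_measure1E//; last 2 first.
- rewrite -[X in measurable X]setTI.
  by apply: (measurable_funD (f := id) (g := cst v0)).
- by rewrite -[X in measurable X]setTI; exact: measurable_cV_shift.
by congr (_ * _)%E; [exact: lebesgue_measure_shift|exact: IH].
Qed.

Definition cube n (B : R) : set 'cV[R]_n := [set x | forall i, -B <= x i 0 <= B].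
Arguments cube : clear implicits.

Lemma measurable_cube n B : measurable (cube n B).
Proof.
rewrite (_ : cube n B = \bigcap_(i in [set: 'I_n])
    ((fun x : 'cV[R]_n => x i 0) @^-1` `[-B, B]%classic)); last first.
  apply/seteqP; split => x /= h i; first by move=> _ /=; rewrite in_itv/=; exact: h.
  by have := h i Logic.I; rewrite /= in_itv.
apply: fin_bigcap_measurable => // i _; rewrite -[X in measurable X]setTI.
by apply: (@measurable_cV_entry _ _ i setT).
Qed.

Lemma lebesgue_cube n B : 0 <= B -> lebesgue R n (cube n B) = ((2 * B) ^+ n)%:E.
Proof.
move=> B0; elim: n => [|n IH].
  rewrite expr0 /= diracE mem_set//= => -[].
  by [].
rewrite /= /lebesgue_cons /pushforward.
rewrite (_ : _ @^-1` _ = `[-B, B]%classic `*` cube n B); last first.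
  apply/seteqP; split => -[x y] /=.
    move=> h; split; first by have := h ord0; rewrite cV_cons0 in_itv.
    by move=> i; have := h (lift ord0 i); rewrite cV_consS.
  move=> [/=]; rewrite in_itv/= => h1 h2 i.
  by case: (unliftP ord0 i) => [j ->|->]; rewrite ?cV_consS ?cV_cons0//; exact: h2.
rewrite product_measure1E//; last exact: measurable_cube.
have lB : lebesgue_measure (`[-B, B]%classic : set R) = (2 * B)%:E.
  rewrite lebesgue_measure_itv/= lte_fin; case: ifPn => [_|].
    by rewrite -EFinB; congr EFin; ring.
  by rewrite -leNgt => BB; congr EFin; lra.
by rewrite exprS EFinM; congr (_ * _)%E; [exact: lB|exact: IH].
Qed.

End translation_invariance.
Arguments cube {R} n B.

Section null_sets.
Variables (R : realType) (n : nat).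

Local Notation vec := 'cV[R]_n.
Local Notation mu := (lebesgue R n).

Lemma lebesgue_setT_gt0 : (0 < mu setT)%E.
Proof.
have : (0 < mu (cube n 1%R))%E.
  by rewrite lebesgue_cube// lte_fin exprn_gt0// mulr_gt0.
move=> /lt_le_trans; apply.
by apply: le_measure => //; rewrite inE//; exact: measurable_cube.
Qed.

(** Integrate the indicator of x + M y \in A over all pairs (x, y). Integrating
first in x gives 0, because the translates of A are null. Integrating first in y
gives the measure of the preimage of A for every x, because the set of these y
is a translate of that preimage. The whole space has positive measure, so the
preimage is null. *)
Lemma lebesgue_mulmx_null (M : 'M[R]_n) (A : set vec) : M \in unitmx ->
  measurable A -> mu A = 0%E -> mu ((fun x => M *m x) @^-1` A) = 0%E.
Proof.
move=> uM mA A0.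
pose f (z : vec * vec) : \bar R := (\1_A (z.1 + M *m z.2))%:E.
have madd : measurable_fun setT (fun z : vec * vec => z.1 + M *m z.2).
  apply: measurable_cV_add => //.
  exact: (measurableT_comp (measurable_cV_mulmx M) measurable_snd).
have mf : measurable_fun setT f.
  apply/measurable_EFinP.
  exact: (measurableT_comp (measurable_indic _) madd).
have f0 z : (0 <= f z)%E by rewrite lee_fin.
have := @fubini_tonelli _ _ _ _ _ mu mu f mf f0.
rewrite /fubini_F /fubini_G.
under eq_integral => x _.
  rewrite (_ : \int[mu]_y f (x, y) = mu ((fun y => M *m y) @^-1` A))%E; last first.
    rewrite /f /=.
    pose B := (fun y : vec => x + M *m y) @^-1` A.
    have mB : measurable B.
      rewrite -[X in measurable X]setTI.
      apply: (measurable_cV_add (f := cst x)) => //.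
      exact: measurable_cV_mulmx.
    transitivity (mu B).
      rewrite -[X in mu X](setIT B).
      exact: (@integral_indic _ _ _ mu setT measurableT B mB).
    rewrite -(@lebesgue_shift _ _ (- (invmx M *m x)))//.
    congr (mu _); rewrite /B; apply/seteqP; split => y /=;
    by rewrite mulmxDr mulmxN mulmxA mulmxV// mul1mx addrC subrK.
  over.
rewrite integral_cst//=.
under [X in _ = X -> _]eq_integral => y _.
  rewrite (_ : \int[mu]_x f (x, y) = 0)%E; last first.
    rewrite /f /=.
    pose B := (fun x : vec => x + M *m y) @^-1` A.
    have mB : measurable B.
      rewrite -[X in measurable X]setTI.
      exact: measurable_cV_shift.
    transitivity (mu B).
      rewrite -[X in mu X](setIT B).
      exact: (@integral_indic _ _ _ mu setT measurableT B mB).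
    by rewrite lebesgue_shift.
  over.
rewrite integral0 => /eqP; rewrite mule_eq0 => /orP[/eqP//|/eqP h].
by have := lebesgue_setT_gt0; rewrite h ltxx.
Qed.

Lemma ae_mulmx (M : 'M[R]_n) (P : vec -> Prop) : M \in unitmx ->
  (\forall x \ae mu, P x) -> \forall x \ae mu, P (M *m x).
Proof.
move=> uM [A [mA A0 PA]]; exists ((fun x => M *m x) @^-1` A); split.
- by rewrite -[X in measurable X]setTI; exact: measurable_cV_mulmx.
- exact: lebesgue_mulmx_null.
- by move=> x /= nP; exact: PA.
Qed.

End null_sets.

(** * Borel sets, boundedness and integrability *)

Section borel.
Variables (R : realType) (n : nat).
Local Notation vec := 'cV[R]_n.
Local Notation mu := (lebesgue R n).

Lemma cV_ballP (x y : vec) e : ball x e y <-> 0 < e /\ forall i, `|x i 0 - y i 0| < e.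
Proof.
split=> [[e0 h]|[e0 h]]; split => // i; first exact: h.
by move=> j; rewrite (ord1 j); exact: h.
Qed.

Definition rat_box (q : 'cV[rat]_n * nat) : set vec :=
  [set x : vec | forall i, `|x i 0 - ratr (q.1 i 0)| < q.2.+1%:R^-1].

Lemma measurable_rat_box q : measurable (rat_box q).
Proof.
rewrite (_ : rat_box q = \bigcap_(i in [set: 'I_n])
    ((fun x : vec => x i 0) @^-1` (ball (ratr (q.1 i 0) : R) q.2.+1%:R^-1))); last first.
  apply/seteqP; split => x /= h i; first by move=> _; rewrite /ball/= distrC; exact: h.
  by have := h i Logic.I; rewrite /ball/= distrC.
apply: fin_bigcap_measurable => // i _; rewrite -[X in measurable X]setTI.
by apply: (@measurable_cV_entry _ _ i setT) => //; exact: measurable_ball.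
Qed.

(** Boxes with rational centers are measurable for the sigma-algebra generated by
the coordinates, and an open set is a countable union of such boxes. *)
Lemma open_cV_measurable (A : set vec) : open A -> measurable A.
Proof.
move=> oA.
pose F (k : nat) := if unpickle k is Some q then
  (if `[< rat_box q `<=` A >] then rat_box q else set0) else set0.
rewrite (_ : A = \bigcup_k F k); last first.
  apply/seteqP; split => x; last first.
    by move=> [k _]; rewrite /F; case: unpickle => // q; case: asboolP => // h /h.
  move=> Ax; have /nbhs_ballP[e /= e0 eA] : nbhs x A by exact: open_nbhs_nbhs.
  pose m := Num.truncn (2 / e).
  have me : m.+1%:R^-1 < e / 2.
    rewrite -[e / 2]invrK ltf_pV2 ?posrE ?invr_gt0 ?divr_gt0// invf_div.
    exact: truncnS_gt.
  have /choice[q qP] : forall i, exists q : rat, `|x i 0 - ratr q| < m.+1%:R^-1.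
    move=> i; have [|q] := @rat_in_itvoo R (x i 0 - m.+1%:R^-1) (x i 0 + m.+1%:R^-1).
      by rewrite ltrD2l gtrN// invr_gt0.
    rewrite in_itv/= => h; exists q.
    by rewrite distrC ltr_distl.
  exists (pickle (\col_i q i, m)) => //; rewrite /F pickleK.
  rewrite asboolT; first by move=> i /=; rewrite mxE.
  move=> y yq; apply: eA; apply/cV_ballP; split => // i.
  have := yq i; have := qP i; rewrite /= mxE => h1 h2.
  rewrite (le_lt_trans (ler_distD (ratr (q i)) _ _))// (splitr e).
  rewrite ltrD//; first exact: lt_trans me.
  by rewrite distrC; exact: lt_trans me.
apply: bigcup_measurable => k _; rewrite /F; case: unpickle => // q.
case: ifP => // _; exact: measurable_rat_box.
Qed.

Lemma closed_cV_measurable (A : set vec) : closed A -> measurable A.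
Proof.
by move=> cA; rewrite -(setCK A); apply: measurableC; apply: open_cV_measurable; rewrite openC.
Qed.

Lemma compact_cV_measurable (A : set vec) : compact A -> measurable A.
Proof.
move=> cA; apply: closed_cV_measurable; exact: compact_closed.
Qed.

Lemma continuous_cV_measurable (D : set vec) (f : vec -> R) : open D ->
  (forall x, D x -> {for x, continuous f}) -> measurable_fun D f.
Proof.
move=> oD cf mD; apply: (measurability _ (RGenOpens.measurableE R)) => //.
move=> _ [_ [a [b ->]] <-].
apply: open_cV_measurable; rewrite openE => x [Dx fx].
apply: filterI; first exact: open_nbhs_nbhs.
by apply: (cf x Dx); apply: open_nbhs_nbhs; split => //; exact: interval_open.
Qed.

Lemma lebesgue_measurable_borel (D : set vec) (f : vec -> R) :
  measurable D -> measurable_fun D f -> lebesgue_measurable D f.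
Proof.
move=> mD mf Y mY; exists (D `&` f @^-1` Y); first exact: mf.
by exists set0; [exact: negligible_set0|rewrite setU0].
Qed.

Lemma compact_cV_bounded (C : set vec) : compact C ->
  exists2 B, 0 < B & C `<=` cube n B.
Proof.
move=> /compact_bounded [M [Mr MC]]; exists (`|M| + 1).
  by rewrite ltr_pwDr.
move=> x Cx i; rewrite -ler_norml.
apply: (@le_trans _ _ `|x|); last first.
  by apply: MC => //; rewrite (le_lt_trans (ler_norm _))// ltrDl.
rewrite [leRHS]mx_normrE; apply: (le_trans _ (le_bigmax _ _ (i, 0))) => //=.
Qed.

Lemma compact_fun_bounded (C : set vec) (f : vec -> R) : compact C ->
  (forall x, C x -> {for x, continuous f}) ->
  exists2 M, 0 < M & forall x, C x -> `|f x| <= M.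
Proof.
move=> cC cf; have : compact (f @` C).
  apply: continuous_compact => //; apply: continuous_in_subspaceT => x.
  by rewrite inE; exact: cf.
move=> /compact_bounded [M [Mr MC]]; exists (`|M| + 1).
  by rewrite ltr_pwDr.
move=> x Cx; apply: MC; last by exists x.
by rewrite (le_lt_trans (ler_norm _))// ltrDl.
Qed.

Lemma lebesgue_bounded_lty (D : set vec) (B : R) : 0 <= B -> measurable D ->
  D `<=` cube n B -> (mu D < +oo)%E.
Proof.
move=> B0 mD DB; apply: (@le_lt_trans _ _ ((2 * B) ^+ n)%:E); last by rewrite ltry.
rewrite -lebesgue_cube//; apply: le_measure => //; rewrite inE//.
exact: measurable_cube.
Qed.

Lemma in_Lp_bounded (q : R) (D : set vec) (f : vec -> R) (B M : R) : 0 < q -> 0 <= B ->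
  measurable D -> D `<=` cube n B -> measurable_fun D f ->
  (forall x, D x -> `|f x| <= M) -> in_Lp q%:E D f.
Proof.
move=> q0 B0 mD DB mf fM; split; first exact: lebesgue_measurable_borel.
rewrite /finite_norm unlock; apply: poweR_lty.
have mfD : measurable_fun setT (f \_ D).
  exact: (@measurable_restrictT _ _ vec R D f mD).1.
apply: (@le_lt_trans _ _ (\int[mu]_(x in D) (`|M| `^ q)%:E)%E).
  rewrite [leRHS]integral_mkcond.
  apply: ge0_le_integral => //.
  - by move=> x _; rewrite poweR_ge0.
  - apply: (measurableT_comp (measurable_poweR _)).
    apply: (measurableT_comp (@abse_measurable R setT)).
    by apply/measurable_EFinP.
  - by apply: (@measurable_restrictT _ _ vec (\bar R) D _ mD).1; exact: measurable_cst.
  - move=> x _ /=; rewrite /patch; case: ifPn => xD; last first.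
      by rewrite normr0 powR0// gt_eqF.
    rewrite lee_fin ge0_ler_powR ?nnegrE//; first exact: ltW.
    by apply: (le_trans _ (ler_norm _)); apply: fM; rewrite inE in xD.
rewrite integral_cst// lte_mul_pinfty ?lee_fin ?powR_ge0//.
exact: lebesgue_bounded_lty DB.
Qed.

End borel.

(** * Integration by parts *)

Section lines.
Variables (R : realType) (V : normedModType R).

(** The mean value theorem and the calculus rules for one real variable become
available for partial derivatives by restriction to a line. *)
Lemma is_derive_line (f : V -> R) (x v : V) (t : R) (df : R) :
  is_derive (x + t *: v) v f df <-> is_derive t 1 (fun h => f (x + h *: v)) df.
Proof.
have E : (fun h : R => h^-1 *: ((f \o shift (x + t *: v)) (h *: v) - f (x + t *: v))) =
  (fun h : R => h^-1 *: (((fun h => f (x + h *: v)) \o shift t) (h *: (1 : R)) - f (x + t *: v))).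
  apply/funext => h /=; congr (_ *: (f _ - _)).
  by rewrite scaler1 scalerDl addrCA.
by split=> -[d1 d2]; (split; [move: d1|move: d2]); rewrite /derivable /derive E.
Qed.

End lines.

Section integral_of_derivative.
Variables (R : realType) (n : nat).
Local Notation vec := 'cV[R]_n.
Local Notation mu := (lebesgue R n).
Local Notation e i := (delta_mx i 0 : vec).

Lemma integral_shift (v : vec) (f : vec -> R) : measurable_fun setT f ->
  mu.-integrable setT (EFin \o f) ->
  mu.-integrable setT (EFin \o (fun x => f (x + v))) /\
  (\int[mu]_x (f (x + v))%:E = \int[mu]_x (f x)%:E)%E.
Proof.
move=> mf intf.
have tr (h : vec -> \bar R) :
    (\int[mu]_x h x = \int[pushforward mu (fun x : vec => (x + v)%R)]_x h x)%E.
  apply/esym; apply: eq_measure_integral; first exact: measurable_cV_shift.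
  by move=> mv A mA _; exact: lebesgue_shift.
have mfE : measurable_fun setT (EFin \o f) by apply/measurable_EFinP.
have intv : mu.-integrable setT (EFin \o (fun x => f (x + v))).
  apply/integrableP; split.
    by apply/measurable_EFinP; exact: (measurableT_comp mf (measurable_cV_shift v)).
  move/integrableP : intf => [_].
  rewrite [X in (X < _)%E -> _]tr ge0_integral_pushforward//.
    exact: measurable_cV_shift.
  exact: measurableT_comp.
split => //.
by rewrite [RHS]tr integral_pushforward//; exact: measurable_cV_shift.
Qed.

Lemma integrable_cube_bounded (f : vec -> R) (B M : R) : 0 <= B ->
  measurable_fun setT f -> (forall x, `|f x| <= M) ->
  (forall x, ~ cube n B x -> f x = 0) -> mu.-integrable setT (EFin \o f).
Proof.
move=> B0 mf fM f0.
have mc : measurable (cube n B : set vec) by exact: measurable_cube.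
have : mu.-integrable (cube n B) (EFin \o f).
  apply: measurable_bounded_integrable => //.
  - exact: lebesgue_bounded_lty B0 _ _.
  - exact: measurable_funTS.
  - exists M; split; first exact: num_real.
    move=> a Ma x _; exact: le_trans (fM x) (ltW Ma).
rewrite integrable_mkcond// (_ : _ \_ _ = EFin \o f)//.
apply/funext => x; rewrite /patch; case: ifPn => //= xB; rewrite f0//.
by move=> h; rewrite mem_set in xB.
Qed.

(** The difference quotients of psi have integral 0 by translation invariance.
The mean value theorem bounds them, and dominated convergence applies. *)
Lemma integral_partial0 (i : 'I_n) (psi dpsi : vec -> R) (B M : R) : 0 <= B ->
  (forall x, is_derive x (e i) psi (dpsi x)) ->
  measurable_fun setT psi -> measurable_fun setT dpsi ->
  (forall x, `|psi x| <= M) -> (forall x, `|dpsi x| <= M) ->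
  (forall x, ~ cube n B x -> psi x = 0) ->
  mu.-integrable setT (EFin \o dpsi) /\ (\int[mu]_x (dpsi x)%:E = 0)%E.
Proof.
move=> B0 dp mp mdp pM dM p0.
have M0 : 0 <= M by apply: le_trans (dM 0).
have intp : mu.-integrable setT (EFin \o psi).
  exact: integrable_cube_bounded pM p0.
pose f_ k x := ((psi (x + k.+1%:R^-1 *: e i) - psi x) * k.+1%:R)%:E.
have f_0 k : (\int[mu]_x f_ k x = 0)%E.
  have [i1 e1] := integral_shift (k.+1%:R^-1 *: e i) mp intp.
  rewrite /f_; under eq_integral do rewrite EFinM EFinB.
  rewrite integralZr//; last exact: integrableB.
  by rewrite integralB// e1 subee ?mul0e// integrable_fin_num.
have mf_ k : measurable_fun setT (f_ k).
  apply/measurable_EFinP; apply: measurable_funM => //; apply: measurable_funB => //.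
  exact: (measurableT_comp mp (measurable_cV_shift _)).
have f_f x : f_ ^~ x @ \oo --> (dpsi x)%:E.
  apply: cvg_EFin; first by apply: nearW.
  have [dx Dx] := dp x.
  have c0 : (fun k : nat => k.+1%:R^-1 : R) @ \oo --> (0 : R)^'.
    move=> A [r r0 rA]; have h : (\forall k \near \oo, ball (0 : R) r (k.+1%:R^-1)).
      exact: (@cvg_harmonic R) (nbhsx_ballx _ _ r0).
    apply: filterS h => k kr.
    have hk : k.+1%:R^-1 != 0 :> R by rewrite invr_eq0 pnatr_eq0.
    exact: (rA _ kr hk).
  rewrite -Dx; have := cvg_comp _ _ c0 dx.
  apply: cvg_trans; apply: near_eq_cvg; apply: nearW => k /=.
  by rewrite /f_ /= invrK [_ + x]addrC [RHS]mulrC.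
(* The supports are enlarged by 1 because the steps of the quotients are at
   most 1. *)
have f_g x k : (`|f_ k x| <= (M * \1_(cube n (B + 1)) x)%:E)%E.
  rewrite lee_fin indicE; have k0 : 0 < k.+1%:R^-1 :> R by rewrite invr_gt0.
  have [xB|xB] := pselect (cube n (B + 1) x); last first.
    have xB1 : ~ cube n B x.
      by move=> h; apply: xB => j; have /andP[h1 h2] := h j; apply/andP; split; lra.
    have xB2 : ~ cube n B (x + k.+1%:R^-1 *: e i).
      have k1 : k.+1%:R^-1 <= 1 :> R by rewrite invf_le1// ler1n.
      move=> h; apply: xB => j; have := h j; rewrite !mxE eqxx andbT.
      move: k0 k1; move: (k.+1%:R^-1) => d d0 d1.
      by case: (_ == _) => /=; rewrite ?mulr1 ?mulr0 => /andP[h1 h2]; apply/andP; split; lra.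
    by rewrite memNset// mulr0 !p0// subrr mul0r normr0.
  rewrite mem_set// mulr1.
  pose dl (t : R) := dpsi (x + t *: e i).
  have dline (t : R) : is_derive t 1 (fun t : R => psi (x + t *: e i)) (dl t).
    exact: (is_derive_line psi x (e i) t (dl t)).1 (dp _).
  have [|t tk] := @MVT R (fun t : R => psi (x + t *: e i)) dl 0 k.+1%:R^-1 k0 (fun t _ => dline t).
    by apply: derivable_within_continuous => t _; exact: ex_derive.
  rewrite scale0r addr0 subr0 => ->.
  by rewrite -mulrA mulVf ?pnatr_eq0// mulr1; exact: dM.
have ig : mu.-integrable setT (fun x => (M * \1_(cube n (B + 1)) x)%:E).
  apply: (@integrable_cube_bounded _ (B + 1) M); first by rewrite addr_ge0.
  - apply: measurable_funM => //; apply: measurable_indic; exact: measurable_cube.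
  - move=> x; rewrite normrM (ger0_norm M0) ler_piMr//.
    by rewrite indicE; case: (_ \in _); rewrite ?normr1 ?normr0.
  - by move=> x xB; rewrite indicE memNset// mulr0.
have [] := @dominated_convergence _ _ _ mu setT measurableT f_ (EFin \o dpsi) _ mf_ _ _ ig.
- exact/measurable_EFinP.
- by apply: aeW => x _; exact: f_f.
- by apply: aeW => x k _; exact: f_g.
move=> i1 _ c1; split => //.
move: c1; rewrite (_ : [sequence _]_n = cst 0%E); last by apply/funext => k; exact: f_0.
by move=> /cvg_lim <-//; rewrite lim_cst.
Qed.

End integral_of_derivative.

Section weak_derivatives.
Variables (R : realType) (n : nat).
Local Notation vec := 'cV[R]_n.
Local Notation mu := (lebesgue R n).
Local Notation e i := (delta_mx i 0 : vec).

Lemma near_off_compact (C : set vec) (f : vec -> R) (x : vec) : compact C ->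
  (forall x, ~ C x -> f x = 0) -> ~ C x -> \forall y \near x, f y = 0.
Proof.
move=> cC f0 Cx; have oC : open (~` C).
  by rewrite openC; exact: compact_closed.
have : nbhs x (~` C) by exact: open_nbhs_nbhs.
by apply: filterS => y; exact: f0.
Qed.

Lemma pderiv_off_compact (C : set vec) (phi : vec -> R) s : compact C ->
  (forall x, ~ C x -> phi x = 0) -> forall x, ~ C x -> pderiv s phi x = 0.
Proof.
move=> cC p0; elim: s => [|i s IH]; first exact: p0.
move=> x Cx /=; have h := near_off_compact cC IH Cx.
rewrite (@near_eq_derive _ _ _ _ (cst 0) x (e i)) ?derive_cst//.
Qed.

Lemma test_function_pderiv D (phi : vec -> R) s : test_function D phi ->
  test_function D (pderiv s phi).
Proof.
move=> [dphi [C [cC CD p0]]]; split.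
  by move=> t x; rewrite /pderiv -foldr_cat; exact: dphi.
by exists C; split => //; exact: pderiv_off_compact.
Qed.

Lemma test_function_continuous D (phi : vec -> R) : test_function D phi -> continuous phi.
Proof. by move=> [d _] x; apply: differentiable_continuous; exact: (d [::]). Qed.

Lemma test_function_derive D (phi : vec -> R) i x : test_function D phi ->
  is_derive x (e i) phi (pderiv [:: i] phi x).
Proof. by move=> [d _]; apply: derivableP; apply: diff_derivable; exact: (d [::]). Qed.

(** Outside C the product vanishes near every point, so that the discontinuities
of f do not matter. *)
Lemma continuous_mul_test (D C : set vec) (f phi : vec -> R) : compact C -> C `<=` D ->
  (forall x, D x -> {for x, continuous f}) -> continuous phi ->
  (forall x, ~ C x -> phi x = 0) -> continuous (fun x => f x * phi x).
Proof.
move=> cC CD cf cphi p0 x; have [Cx|Cx] := pselect (C x).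
  by apply: continuousM; [exact/cf/CD|exact: cphi].
have h := near_off_compact cC p0 Cx.
apply: (@cvg_trans _ (cst (0:R) @ nbhs x)).
  apply: (@near_eq_cvg _ _ (nbhs x)); near=> y.
  by rewrite (near h y) ?mulr0.
by rewrite p0// mulr0; exact: cvg_cst.
Unshelve. all: by end_near. Qed.

Lemma compact_support_bounded (C : set vec) (f : vec -> R) : compact C ->
  continuous f -> (forall x, ~ C x -> f x = 0) ->
  exists2 M, 0 < M & forall x, `|f x| <= M.
Proof.
move=> cC cf f0; have [|M M0 fM] := @compact_fun_bounded _ _ C f cC.
  by move=> x _; exact: cf.
exists M => // x; have [/fM//|Cx] := pselect (C x).
by rewrite f0// normr0 ltW.
Qed.

Lemma continuous_measurable_cV (f : vec -> R) : continuous f -> measurable_fun setT f.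
Proof.
move=> cf; apply: continuous_cV_measurable; first exact: openT.
by move=> x _; exact: cf.
Qed.

Lemma Rintegral_off (D : set vec) (f : vec -> R) : (forall x, ~ D x -> f x = 0) ->
  (\int[mu]_(x in D) f x = fine (\int[mu]_x (f x)%:E))%R.
Proof.
move=> f0; rewrite /Rintegral; congr fine; rewrite integral_mkcond.
congr integral; apply/funext => x; rewrite /patch; case: ifPn => // xD.
by rewrite f0// => h; rewrite mem_set in xD.
Qed.

(** The product of v and phi, which vanishes off a compact subset of D, has partial
derivatives on the whole space, and integral_partial0 applies to it. *)
Lemma integration_by_parts_test (D : set vec) i (v dv phi : vec -> R) : open D ->
  (forall x, D x -> {for x, continuous v}) -> (forall x, D x -> {for x, continuous dv}) ->
  (forall x, D x -> is_derive x (e i) v (dv x)) -> test_function D phi ->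
  \int[mu]_(x in D) (v x * pderiv [:: i] phi x) = - \int[mu]_(x in D) (dv x * phi x).
Proof.
move=> oD cv cdv dv' tphi; have [dphi [C [cC CD p0]]] := tphi.
have q0 := @pderiv_off_compact C phi [:: i] cC p0.
have cphi := test_function_continuous tphi.
have cq := test_function_continuous (test_function_pderiv [:: i] tphi).
pose A x := v x * pderiv [:: i] phi x; pose B x := dv x * phi x.
pose F x := v x * phi x.
have cA : continuous A by exact: continuous_mul_test cC CD _ _ _.
have cB : continuous B by exact: continuous_mul_test cC CD _ _ _.
have cF : continuous F by exact: continuous_mul_test cC CD _ _ _.
have A0 x : ~ C x -> A x = 0 by move=> h; rewrite /A q0 ?mulr0.
have B0 x : ~ C x -> B x = 0 by move=> h; rewrite /B p0 ?mulr0.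
have F0 x : ~ C x -> F x = 0 by move=> h; rewrite /F p0 ?mulr0.
have [b b0 Cb] := compact_cV_bounded cC.
have [MA MA0 AM] := compact_support_bounded cC cA A0.
have [MB MB0 BM] := compact_support_bounded cC cB B0.
have [MF MF0 FM] := compact_support_bounded cC cF F0.
have dF x : is_derive x (e i) F (A x + B x).
  have [Cx|Cx] := pselect (C x).
    have := is_deriveM (dv' x (CD _ Cx)) (test_function_derive i x tphi).
    move=> h; apply: is_derive_eq h _; rewrite /A /B.
    by congr (_ + _); rewrite /GRing.scale/= mulrC.
  have h := near_off_compact cC F0 Cx.
  rewrite A0// B0// addr0.
  apply: (@near_eq_is_derive _ _ _ (cst 0)) => //.
  by apply: filterS h.
have cb (f : vec -> R) : (forall x, ~ C x -> f x = 0) -> forall x, ~ cube n b x -> f x = 0.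
  by move=> f0 x xb; apply: f0 => /Cb.
have iA := integrable_cube_bounded (ltW b0) (continuous_measurable_cV cA) AM (cb _ A0).
have iB := integrable_cube_bounded (ltW b0) (continuous_measurable_cV cB) BM (cb _ B0).
have FM' x : `|F x| <= MF + (MA + MB).
  by rewrite (le_trans (FM x))// lerDl addr_ge0// ltW.
have ABM x : `|A x + B x| <= MF + (MA + MB).
  by have := ler_normD (A x) (B x); have := AM x; have := BM x; lra.
have [_] := @integral_partial0 R n i F (fun x => A x + B x) b (MF + (MA + MB)) (ltW b0) dF
  (continuous_measurable_cV cF)
  (measurable_funD (continuous_measurable_cV cA) (continuous_measurable_cV cB)) FM' ABM (cb _ F0).
have off (f : vec -> R) : (forall x, ~ C x -> f x = 0) -> forall x, ~ D x -> f x = 0.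
  by move=> f0 x xb; apply: f0 => /CD.
rewrite (Rintegral_off (off _ A0)) (Rintegral_off (off _ B0)).
under eq_integral do rewrite EFinD.
rewrite integralD//.
rewrite -[X in (X + _)%E]fineK ?integrable_fin_num//.
rewrite -[X in (_ + X)%E]fineK ?integrable_fin_num//.
rewrite -EFinD => -[] /eqP; rewrite addr_eq0 => /eqP h.
exact: h.
Qed.

Lemma in_Lp_loc_continuous (D : set vec) (f : vec -> R) : open D ->
  (forall x, D x -> {for x, continuous f}) -> in_Lp_loc 1%E D f.
Proof.
move=> oD cf C cC CD.
have [b b0 Cb] := compact_cV_bounded cC.
have [M M0 fM] := compact_fun_bounded cC (fun x Cx => cf x (CD x Cx)).
have mC := compact_cV_measurable cC.
apply: in_Lp_bounded (ltW b0) mC Cb _ fM => //.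
apply: (measurable_funS (open_cV_measurable oD) CD).
exact: continuous_cV_measurable.
Qed.

Section smooth.
Variables (D : set vec) (u : vec -> R) (du : 'I_n -> vec -> R) (d2u : 'I_n -> 'I_n -> vec -> R).
Hypothesis oD : open D.
Hypothesis cu : forall x, D x -> {for x, continuous u}.
Hypothesis cdu : forall i x, D x -> {for x, continuous (du i)}.
Hypothesis cd2u : forall i j x, D x -> {for x, continuous (d2u i j)}.
Hypothesis udu : forall i x, D x -> is_derive x (e i) u (du i x).
Hypothesis dud2u : forall i j x, D x -> is_derive x (e j) (du i) (d2u i j x).

Lemma weak_deriv_nil : weak_deriv D [::] u u.
Proof.
split; [exact: in_Lp_loc_continuous|exact: in_Lp_loc_continuous|].
by move=> phi _; rewrite expr0 mul1r.
Qed.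

Lemma weak_deriv_first i : weak_deriv D [:: i] u (du i).
Proof.
split; [exact: in_Lp_loc_continuous| |].
  by apply: in_Lp_loc_continuous => // x; exact: cdu.
move=> phi tphi; rewrite expr1 mulN1r.
exact: (integration_by_parts_test oD cu (@cdu i) (@udu i)).
Qed.

Lemma weak_deriv_second i j : weak_deriv D [:: i; j] u (d2u i j).
Proof.
split; [exact: in_Lp_loc_continuous| |].
  by apply: in_Lp_loc_continuous => // x; exact: cd2u.
move=> phi tphi; rewrite /= sqrrN expr1n mul1r.
have tj := test_function_pderiv [:: j] tphi.
rewrite (integration_by_parts_test oD cu (@cdu i) (@udu i) tj).
by rewrite (integration_by_parts_test oD (@cdu i) (@cd2u i j) (@dud2u i j) tphi) opprK.
Qed.

(** The classical derivatives are the weak ones; being bounded on a bounded set,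
they belong to every space L^q. *)
Lemma sobolev_smooth (q : R) (b : R) (M : R) : 0 < q -> 0 <= b -> D `<=` cube n b ->
  (forall x, D x -> `|u x| <= M) -> (forall i x, D x -> `|du i x| <= M) ->
  (forall i j x, D x -> `|d2u i j x| <= M) -> sobolev 2 q%:E D u.
Proof.
move=> q0 b0 Db uM duM d2uM; have mD := open_cV_measurable oD.
have Lp f : (forall x, D x -> {for x, continuous f}) ->
    (forall x, D x -> `|f x| <= M) -> in_Lp q%:E D f.
  move=> cf fM.
  exact: (in_Lp_bounded q0 b0 mD Db (continuous_cV_measurable oD cf) fM).
split; first exact: Lp.
move=> [|i [|j [|//]]] _.
- by exists u; [exact: Lp|exact: weak_deriv_nil].
- by exists (du i); [apply: Lp; [exact: cdu|exact: duM]|exact: weak_deriv_first].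
- by exists (d2u i j); [apply: Lp; [exact: cd2u|exact: d2uM]|exact: weak_deriv_second].
Qed.

End smooth.
End weak_derivatives.

(** * The Euclidean norm *)

Section enorm_theory.
Variables (R : realType) (n : nat).
Local Notation vec := 'cV[R]_n.

Lemma dot_ge0 (x : vec) : 0 <= dot x x.
Proof. by apply: sumr_ge0 => i _; rewrite -expr2 sqr_ge0. Qed.

Lemma enorm_ge0 (x : vec) : 0 <= enorm x.
Proof. exact: sqrtr_ge0. Qed.

Lemma sqr_enorm (x : vec) : enorm x ^+ 2 = dot x x.
Proof. by rewrite sqr_sqrtr// dot_ge0. Qed.

Lemma enorm0 : enorm (0 : vec) = 0.
Proof. by rewrite /enorm /dot big1 ?sqrtr0// => i _; rewrite mxE mulr0. Qed.

Lemma coord_le_enorm (x : vec) i : `|x i 0| <= enorm x.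
Proof.
rewrite -sqrtr_sqr ler_wsqrtr// /dot (bigD1 i)//= -expr2 lerDl.
by apply: sumr_ge0 => j _; rewrite -expr2 sqr_ge0.
Qed.

Lemma enorm_gt0 (x : vec) : x <> 0 -> 0 < enorm x.
Proof.
move=> x0; rewrite lt0r enorm_ge0 andbT; apply/eqP => h; apply: x0.
apply/colP => i; rewrite mxE; apply/eqP; rewrite -normr_eq0 eq_le normr_ge0 andbT.
by rewrite -h coord_le_enorm.
Qed.

Lemma enorm_le_sum (x : vec) : enorm x <= \sum_i `|x i 0|.
Proof.
have s0 : 0 <= \sum_i `|x i 0| by apply: sumr_ge0.
rewrite -[leRHS]ger0_norm// -sqrtr_sqr ler_wsqrtr// expr2 mulr_suml.
apply: ler_sum => i _; rewrite -expr2 -real_normK ?num_real// expr2 ler_wpM2l//.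
by rewrite (bigD1 i)//= lerDl; apply: sumr_ge0.
Qed.

Lemma enorm_cube (x : vec) (r : R) : enorm x <= r -> cube n r x.
Proof. by move=> xr i; rewrite -ler_norml (le_trans (coord_le_enorm x i)). Qed.

Lemma continuous_sumr (T : topologicalType) (I : finType) (F : I -> T -> R) (x : T) :
  (forall i, {for x, continuous (F i)}) -> {for x, continuous (fun y => \sum_i F i y)}.
Proof.
move=> cF; rewrite (_ : (fun y => _) = \sum_i F i); last first.
  by apply/funext => y; rewrite fct_sumE.
elim/big_ind : _ => [|f g cf cg|i _]; last exact: cF.
- exact: cst_continuous.
- exact: continuousD.
Qed.

Lemma continuous_mulmx_entry m (M : 'M[R]_(m, n)) i : continuous (fun x : vec => (M *m x) i 0).
Proof.
move=> x; rewrite (_ : (fun y => _) = fun y : vec => \sum_j M i j * y j 0); last first.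
  by apply/funext => y; rewrite mxE.
apply: continuous_sumr => j; apply: continuousM; first exact: cst_continuous.
exact: coord_continuous.
Qed.

Lemma continuous_enorm_mulmx (M : 'M[R]_n) : continuous (fun x : vec => enorm (M *m x)).
Proof.
move=> x.
apply: (@continuous_comp _ _ _ (fun x : vec => dot (M *m x) (M *m x)) Num.sqrt); last first.
  exact: sqrt_continuous.
apply: continuous_sumr => j; apply: continuousM; exact: continuous_mulmx_entry.
Qed.

Lemma continuous_enorm : continuous (@enorm R n).
Proof.
rewrite (_ : @enorm R n = fun x => enorm (1%:M *m x)); first exact: continuous_enorm_mulmx.
by apply/funext => x; rewrite mul1mx.
Qed.

Lemma enorm_mulmx_le (M : 'M[R]_n) : exists2 C, 0 < C & forall x, enorm (M *m x) <= C * enorm x.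
Proof.
exists (1 + \sum_i \sum_j `|M i j|).
  by rewrite ltr_pwDl// ?sumr_ge0// => i _; rewrite sumr_ge0.
move=> x; rewrite (le_trans (enorm_le_sum _))// mulrDl mul1r ler_wpDl ?enorm_ge0//.
rewrite mulr_suml; apply: ler_sum => i _; rewrite mxE mulr_suml.
rewrite (le_trans (ler_norm_sum _ _ _))//; apply: ler_sum => j _.
by rewrite normrM ler_wpM2l// coord_le_enorm.
Qed.

Lemma enorm_mulmx_ge (M : 'M[R]_n) : M \in unitmx ->
  exists2 C, 0 < C & forall x, C * enorm x <= enorm (M *m x).
Proof.
move=> uM; have [C C0 CM] := enorm_mulmx_le (invmx M).
exists C^-1; first by rewrite invr_gt0.
move=> x; rewrite ler_pdivrMl//; have := CM (M *m x).
by rewrite mulmxA mulVmx// mul1mx.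
Qed.

End enorm_theory.

Section open_sets_are_not_null.
Variables (R : realType) (n : nat).
Local Notation vec := 'cV[R]_n.
Local Notation mu := (lebesgue R n).

Lemma open_not_negligible (A : set vec) : open A -> A !=set0 -> ~ mu.-negligible A.
Proof.
move=> oA [x Ax] [N [mN N0 AN]].
have /nbhs_ballP[r /= r0 rA] : nbhs x A by exact: open_nbhs_nbhs.
have : (mu (cube n (r / 2)) <= mu N)%E.
  rewrite -(lebesgue_shift x mN); apply: le_measure.
  - by rewrite inE; exact: measurable_cube.
  - by rewrite inE -[X in measurable X]setTI; exact: measurable_cV_shift.
  - move=> y yc; apply: AN; apply: rA; apply/cV_ballP; split => // i.
    rewrite mxE opprD addrCA subrr addr0 normrN.
    by rewrite (@le_lt_trans _ _ (r / 2))// ?ler_norml ?yc//; lra.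
rewrite N0 lebesgue_cube; last by rewrite divr_ge0// ltW.
by rewrite lee_fin leNgt exprn_gt0// mulrCA divff// mulr1.
Qed.

End open_sets_are_not_null.

(** * The envelope of a function *)

Section envelope.
Variables (R : realType) (n : nat).
Hypothesis n0 : (0 < n)%N.
Local Notation vec := 'cV[R]_n.
Local Notation mu := (lebesgue R n).
Variable f : vec -> R.
Let S (r delta : R) : \bar R := ess_sup_on mu [set x | `|enorm x - r| < delta] (EFin \o f).

Lemma ess_sup_onP (D : set vec) (y : \bar R) :
  (ess_sup_on mu D (EFin \o f) <= y)%E <-> \forall x \ae mu, D x -> ((f x)%:E <= y)%E.
Proof.
rewrite /ess_sup_on; split.
  move=> /ess_supP; apply: filterS => x; rewrite /patch; case: ifPn => [_ h _//|xD _ Dx].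
  by rewrite mem_set in xD.
move=> h; apply/ess_supP; apply: filterS h => x; rewrite /patch.
by case: ifPn => [/set_mem Dx|_ _]; [apply|rewrite leNye].
Qed.

Lemma ess_sup_on_le (A B : set vec) : A `<=` B ->
  (ess_sup_on mu A (EFin \o f) <= ess_sup_on mu B (EFin \o f))%E.
Proof.
move=> AB; apply/ess_sup_onP.
have : (ess_sup_on mu B (EFin \o f) <= ess_sup_on mu B (EFin \o f))%E by [].
by move=> /ess_sup_onP; apply: filterS => x h /AB.
Qed.

(** The essential supremum grows with the width of the shell, so the one-sided
limit that defines the envelope is an infimum. *)
Lemma env_inf r : env f r = ereal_inf (S r @` `]0, +oo[%classic).
Proof.
apply: cvg_lim => //.
have := @nondecreasing_at_right_cvge R (S r) 0 +oo%O.
apply; first by rewrite bnd_simp.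
move=> d1 d2 _ _ d12; apply: ess_sup_on_le => x /= h; exact: lt_le_trans d12.
Qed.

Lemma env_le r delta : 0 < delta -> (env f r <= S r delta)%E.
Proof.
by move=> d0; rewrite env_inf; apply: ereal_inf_lbound; exists delta => //=; rewrite in_itv/= d0.
Qed.

Lemma env_ltP r y : (env f r < y)%E -> exists2 delta, 0 < delta & (S r delta < y)%E.
Proof.
rewrite env_inf => /ereal_inf_lt[z [d /=]]; rewrite in_itv/= andbT => d0 zE zy.
by exists d => //; rewrite zE.
Qed.

(** Upper semicontinuity of the envelope: a shell around s is contained in a wider
shell around a nearby r. *)
Lemma env_near r y : (env f r < y)%E -> \forall s \near r, (env f s < y)%E.
Proof.
move=> /env_ltP[d d0 dy]; have d20 : 0 < d / 2 by rewrite divr_gt0.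
have : nbhs r (ball r (d / 2)) by exact: nbhsx_ballx.
apply: filterS => s; rewrite /ball/= => rs.
apply: le_lt_trans dy; apply: (le_trans (env_le s d20)).
apply: ess_sup_on_le => x /= h; rewrite (splitr d).
rewrite (le_lt_trans (ler_distD s _ _))// ltrD// distrC.
exact: rs.
Qed.

(** One null set must serve all radii. It is the union of those that belong to the
countably many shells with rational center and width 1 / (k + 1); every shell
around a given point contains one of these shells that still contains the
point. *)
Lemma le_env_ae : \forall x \ae mu, ((f x)%:E <= env f (enorm x))%E.
Proof.
pose P (q : rat) (k : nat) (x : vec) :=
  `|enorm x - ratr q| < k.+1%:R^-1 -> ((f x)%:E <= S (ratr q) (k.+1%:R^-1)%R)%E.
have h : \forall x \ae mu, forall m, if unpickle m is Some (q, k) then P q k x else True.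
  apply: ae_foralln => m; case: unpickle => [[q k]|]; last by apply: aeW.
  by apply/ess_sup_onP.
apply: (filterS _ h) => {h} x /= h.
rewrite leNgt; apply/negP => /env_ltP[d d0 dy].
pose k := Num.truncn (2 / d).
have kd : k.+1%:R^-1 < d / 2.
  rewrite -[d / 2]invrK ltf_pV2 ?posrE ?invr_gt0 ?divr_gt0// invf_div.
  exact: truncnS_gt.
have [|q] := @rat_in_itvoo R (enorm x - k.+1%:R^-1) (enorm x + k.+1%:R^-1).
  by rewrite ltrD2l gtrN// invr_gt0.
rewrite in_itv/= => qx.
have := h (pickle (q, k)); rewrite pickleK /P.
have qx' : `|enorm x - ratr q| < k.+1%:R^-1 by rewrite distrC ltr_distl.
move=> /(_ qx'); rewrite leNgt => /negP; apply; apply: le_lt_trans dy.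
apply: ess_sup_on_le => y /= yq.
rewrite (le_lt_trans (ler_distD (ratr q) _ _))// (splitr d) ltrD//.
  exact: lt_trans kd.
by rewrite distrC; exact: lt_trans kd.
Qed.

Lemma env_ub (lo hi C r : R) :
  (\forall x \ae mu, lo < enorm x < hi -> f x <= C) -> lo < r < hi ->
  (env f r <= C%:E)%E.
Proof.
move=> h /andP[r1 r2]; pose d := Num.min (r - lo) (hi - r).
have d0 : 0 < d by rewrite lt_min !subr_gt0 r1.
apply: (le_trans (env_le r d0)); apply/ess_sup_onP.
move: h; apply: filterS => x h /=; rewrite /d lt_min ltr_distlC ltr_distl !lee_fin.
move=> /andP[/andP[h1 h2] /andP[h3 h4]].
by apply: h; lra.
Qed.

(** In positive dimension a shell of small width around r > 0 contains a nonempty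
open set, hence is not null. *)
Lemma env_lb (lo hi C r : R) :
  (\forall x \ae mu, lo < enorm x < hi -> C <= f x) -> 0 < r -> lo < r < hi ->
  (C%:E <= env f r)%E.
Proof.
move=> h r0 /andP[r1 r2]; rewrite leNgt; apply/negP => /env_ltP[d d0 dy].
pose A := [set x : vec | Num.max lo (r - d) < enorm x < Num.min hi (r + d)].
have oA : open A.
  have -> : A = @enorm R n @^-1` `]Num.max lo (r - d), Num.min hi (r + d)[%classic.
    by apply/seteqP; split => x /=; rewrite in_itv.
  apply: open_comp; last exact: interval_open.
  by move=> x _; exact: continuous_enorm.
apply: (open_not_negligible oA).
  exists (r *: delta_mx (Ordinal n0) 0); rewrite /A /=.
  have -> : enorm (r *: delta_mx (Ordinal n0) 0 : vec) = r.
    rewrite /enorm /dot (bigD1 (Ordinal n0))//= big1 ?addr0.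
      by rewrite !mxE !eqxx/= mulr1 -expr2 sqrtr_sqr gtr0_norm.
    by move=> i i0; rewrite !mxE (negbTE i0)/= mulr0 mul0r.
  by rewrite lt_min gt_max r1 r2 /=; apply/andP; split; lra.
have h2 : \forall x \ae mu, `|enorm x - r| < d -> ((f x)%:E <= S r d)%E.
  by apply/ess_sup_onP.
have : \forall x \ae mu, ~ A x.
  apply: filterS2 h h2 => x h1 h2 /=; rewrite /A /= lt_min gt_max.
  move=> /andP[/andP[a1 a2] /andP[a3 a4]].
  have fx : (C%:E <= (f x)%:E)%E by rewrite lee_fin h1// a1.
  have : ((f x)%:E <= S r d)%E by apply: h2; rewrite ltr_distl a2.
  by move=> /(le_trans fx); rewrite leNgt dy.
move=> [N [mN N0 AN]]; exists N; split => // x Ax; apply: AN => /=; exact.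
Qed.

End envelope.

(** * Continuous majorants of upper semicontinuous functions *)

Section sup_convolution.
Variables (R : realType) (rho : R) (f : R -> R).
Hypothesis rho0 : 0 < rho.
Hypothesis f0 : forall r : R, 0 < r < rho -> 0 <= f r.
Hypothesis fb : forall a : R, 0 < a -> exists2 M : R, 0 < M & forall r : R, a < r < rho -> f r <= M.
Hypothesis fusc : forall r y : R, 0 < r < rho -> f r < y -> \forall s \near r, f s < y.

Let term k r s := f s * Num.max 0 (1 - k * `|r - s|).

(** The cones max (0, 1 - k |r - s|) regularize f from above: the supremum is
continuous in r, even for k depending continuously on r (supconv_continuous), it
decreases in k (supconv_anti), and it tends to f r as k grows (supconv_cvg). The
condition 2 / r <= k, which recurs below, keeps the cone at r inside s > r / 2,
away from 0 where f may be unbounded. *)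
Definition supconv (k r : R) := sup [set term k r s | s in `]0, rho[%classic].

Lemma supconv_term_le k r s : 0 <= k -> 0 < s < rho -> term k r s <= f s.
Proof.
move=> k0 sr; rewrite ler_piMr ?f0// ge_max ler01/= gerBl.
by rewrite mulr_ge0.
Qed.

Lemma supconv_term_eq0 k r s : 1 <= k * `|r - s| -> term k r s = 0.
Proof. by move=> h; rewrite /term (_ : Num.max _ _ = 0) ?mulr0// max_l// subr_le0. Qed.

Lemma supconv_term_off k r s : 0 < r -> 2 / r <= k -> s <= r / 2 -> term k r s = 0.
Proof.
move=> r0 kr sr; apply: supconv_term_eq0.
have h : r / 2 <= `|r - s| by rewrite (le_trans _ (ler_norm _))//; lra.
apply: (@le_trans _ _ (2 / r * (r / 2))).
  by have -> : 2 / r * (r / 2) = 1 by field; rewrite gt_eqF.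
by rewrite ler_pM// ?divr_ge0// ltW.
Qed.

Lemma supconv_term_bound k r s a M : 0 < a -> a < r -> 2 / a <= k ->
  (forall r : R, a / 2 < r < rho -> f r <= M) -> 0 <= M -> 0 < s < rho -> term k r s <= M.
Proof.
move=> a0 ar ak fM M0 sr.
have r0 : 0 < r by exact: lt_trans ar.
have k0 : 0 <= k by apply: le_trans ak; rewrite divr_ge0// ltW.
have [sa|sa] := leP s (a / 2).
  rewrite supconv_term_off//; last by apply: (le_trans sa); rewrite ler_pM2r ?invr_gt0// ltW.
  by apply: le_trans ak; rewrite ler_pM2l// lef_pV2 ?posrE// ltW.
by apply: (le_trans (supconv_term_le _ k0 sr)); apply: fM; rewrite sa; case/andP: sr.
Qed.

Lemma supconv_has_sup k r : 0 < r < rho -> 2 / r <= k ->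
  has_sup [set term k r s | s in `]0, rho[%classic].
Proof.
move=> /andP[r0 rr] kr; split.
  by exists (term k r r); exists r => //=; rewrite in_itv/= r0.
have r20 : 0 < r / 2 by rewrite divr_gt0.
have [M M0 fM] := fb r20; exists M => _ [s /= + <-]; rewrite in_itv/= => sr.
have k0 : 0 <= k by apply: le_trans kr; rewrite divr_ge0// ltW.
have [sa|sa] := leP s (r / 2); first by rewrite supconv_term_off// ltW.
by apply: (le_trans (supconv_term_le _ k0 sr)); apply: fM; rewrite sa; case/andP: sr.
Qed.

Lemma supconv_ge_term k r s : 0 < r < rho -> 2 / r <= k -> 0 < s < rho ->
  term k r s <= supconv k r.
Proof.
move=> rr kr sr; apply: (sup_upper_bound (supconv_has_sup rr kr)).
by exists s => //=; rewrite in_itv.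
Qed.

Lemma supconv_le k r y : 0 < r < rho -> (forall s, 0 < s < rho -> term k r s <= y) ->
  supconv k r <= y.
Proof.
move=> /andP[r0 rr] h; apply: ge_sup.
  by exists (term k r r); exists r => //=; rewrite in_itv/= r0.
by move=> _ [s /= + <-]; rewrite in_itv/=; exact: h.
Qed.

Lemma supconv_ge k r : 0 < r < rho -> 2 / r <= k -> f r <= supconv k r.
Proof.
move=> rr kr; apply: le_trans (supconv_ge_term rr kr rr).
by rewrite /term subrr normr0 mulr0 subr0 max_r ?mulr1.
Qed.

Lemma supconv_anti k k' r : 0 < r < rho -> 2 / r <= k -> k <= k' ->
  supconv k' r <= supconv k r.
Proof.
move=> rr kr kk; apply: supconv_le => // s sr.
apply: le_trans (supconv_ge_term rr kr sr).
rewrite ler_wpM2l ?f0// ge_max le_max lexx/= le_max; apply/orP; right.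
by rewrite lerB// ler_wpM2r.
Qed.

Lemma supconv_bound k r a M : 0 < a -> a < r < rho -> 2 / a <= k ->
  (forall r : R, a / 2 < r < rho -> f r <= M) -> 0 <= M -> supconv k r <= M.
Proof.
move=> a0 /andP[ar rr] ak fM M0; apply: supconv_le => [|s sr].
  by rewrite rr andbT; exact: lt_trans ar.
exact: supconv_term_bound ak fM M0 sr.
Qed.

(** Near r the values of f are below y by semicontinuity, and a steep cone vanishes
elsewhere. *)
Lemma supconv_cvg r y : 0 < r < rho -> f r < y ->
  exists2 k0, 0 < k0 & forall k, k0 <= k -> supconv k r <= y.
Proof.
move=> rr fy; have /nbhs_ballP[d /= d0 dP] := fusc rr fy.
exists d^-1; rewrite ?invr_gt0// => k kd; apply: supconv_le => // s sr.
have k0 : 0 <= k by apply: le_trans kd; rewrite invr_ge0 ltW.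
have y0 : 0 <= y by apply: ltW; apply: le_lt_trans fy; exact: f0.
have [rs|rs] := ltP `|r - s| d.
  by apply: (le_trans (supconv_term_le _ k0 sr)); apply/ltW/dP.
rewrite supconv_term_eq0// (@le_trans _ _ (d^-1 * d))//; first by rewrite mulVf// gt_eqF.
by rewrite ler_pM// ?invr_ge0// ltW.
Qed.

Lemma supconv_continuous (kappa : R -> R) r0 : 0 < r0 < rho ->
  {for r0, continuous kappa} -> (\forall r \near r0, 2 / r <= kappa r) ->
  {for r0, continuous (fun r => supconv (kappa r) r)}.
Proof.
move=> /[dup] rr0 /andP[r00 r0r] ck hk.
have r40 : 0 < r0 / 4 by rewrite divr_gt0.
have [M M0 fM] := fb r40.
have hk0 : 2 / r0 <= kappa r0 by exact: nbhs_singleton hk.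
have k00 : 0 <= kappa r0 by apply: le_trans hk0; rewrite divr_ge0// ltW.
pose h r := M * (`|kappa r - kappa r0| * rho + kappa r0 * `|r - r0|).
have ch : {for r0, continuous h}.
  apply: continuousM; first exact: cst_continuous.
  apply: continuousD; apply: continuousM; try exact: cst_continuous.
    apply: continuous_comp; last exact: norm_continuous.
    by apply: continuousB => //; exact: cst_continuous.
  apply: continuous_comp; last exact: norm_continuous.
  by apply: continuousB => //; exact: cst_continuous.
have h00 : h r0 = 0 by rewrite /h !subrr !normr0 mul0r mulr0 addr0 mulr0.
have key r s : 0 < r < rho -> r0 / 2 < r -> 2 / r <= kappa r -> 0 < s < rho ->
    `|term (kappa r) r s - term (kappa r0) r0 s| <= h r.
  move=> /[dup] rr /andP[rp rR] r0r2 kr sr.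
  have h0 : 0 <= h r by rewrite /h mulr_ge0 ?addr_ge0 ?mulr_ge0// ltW.
  have [s4|s4] := leP s (r0 / 4).
    by rewrite !supconv_term_off ?subrr ?normr0//; lra.
  rewrite /term -mulrBr normrM ger0_norm ?f0//.
  have fsM : f s <= M by apply: fM; rewrite s4; case/andP: sr.
  apply: (@le_trans _ _ (M * `|kappa r * `|r - s| - kappa r0 * `|r0 - s| |)).
    apply: ler_pM => //; first exact: f0.
    set A := kappa r * _; set B := kappa r0 * _.
    rewrite ler_norml.
    rewrite /Num.max; have := ler_norm (A - B); have := ler_norm (B - A); rewrite (distrC B A).
    by case: (ltP 0 (1 - A)) => ?; case: (ltP 0 (1 - B)) => *; apply/andP; split; lra.
  rewrite ler_wpM2l// ?(ltW M0)//.
  have -> : kappa r * `|r - s| - kappa r0 * `|r0 - s| =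
    (kappa r - kappa r0) * `|r - s| + kappa r0 * (`|r - s| - `|r0 - s|) by ring.
  rewrite (le_trans (ler_normD _ _))// lerD//.
    rewrite normrM normr_id ler_wpM2l// ler_norml; apply/andP; case/andP: sr => *; split; lra.
  rewrite normrM (ger0_norm k00) ler_wpM2l//.
  have := ler_dist_dist (r - s) (r0 - s).
  by rewrite opprB addrA subrK.
apply/cvgrPdist_le => e e0.
have hne : \forall r \near r0, h r <= e.
  move/cvgrPdist_le : ch => /(_ e e0); apply: filterS => r.
  by rewrite h00 sub0r normrN; apply: le_trans; rewrite ler_norm.
have near_r : \forall r \near r0, r \in `]r0 / 2, rho[.
  by apply: near_in_itvoo; rewrite in_itv/= r0r andbT; lra.
near=> r.
have hr : h r <= e by near: r.
have kr : 2 / r <= kappa r by near: r.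
have : r \in `]r0 / 2, rho[ by near: r.
rewrite in_itv/= => /andP[r02 rR].
have rr : 0 < r < rho by rewrite rR andbT (lt_trans _ r02)// divr_gt0.
rewrite ler_norml; apply/andP; split.
  rewrite lerNl opprB lerBlDr; apply: supconv_le => // s sr.
  have := key r s rr r02 kr sr; rewrite ler_norml => /andP[_ h1].
  have := supconv_ge_term rr0 hk0 sr; lra.
rewrite lerBlDr; apply: supconv_le => // s sr.
have := key r s rr r02 kr sr; rewrite ler_norml => /andP[h1 _].
have := supconv_ge_term rr kr sr; lra.
Unshelve. all: by end_near. Qed.

End sup_convolution.

Lemma continuous_maxr0 (R : realType) (g : R -> R) r : {for r, continuous g} ->
  {for r, continuous (fun s => Num.max 0 (g s))}.
Proof.
move=> cg.
rewrite (_ : (fun s => _) = fun s => (g s + `|g s|) / 2).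
  apply: continuousM; last exact: cst_continuous.
  apply: continuousD => //.
  by apply: continuous_comp => //; exact: norm_continuous.
apply/funext => s; have [h|h] := leP 0 (g s).
  by rewrite ger0_norm//; lra.
by rewrite ltr0_norm//; lra.
Qed.

Section continuous_majorant.
Variables (R : realType) (rho : R) (k : nat -> R).
Hypothesis rho0 : 0 < rho.
Hypothesis k0 : forall n, 0 <= k n.

Let bump n r := k n * Num.max 0 (rho / r - n%:R + 1).

Let bump_ge0 n r : 0 <= bump n r.
Proof. by rewrite mulr_ge0// le_max lexx. Qed.

Let bump_eq0 n r : rho / r + 1 <= n%:R -> bump n r = 0.
Proof. by move=> h; rewrite /bump max_l ?mulr0//; lra. Qed.

Let bump_sum m r : rho / r + 1 <= m%:R ->
  \sum_(0 <= n < (Num.truncn (rho / r)).+2) bump n r = \sum_(0 <= n < m) bump n r.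
Proof.
move=> h; have h2 : rho / r + 1 <= (Num.truncn (rho / r)).+2%:R.
  by rewrite -natr1 lerD2r ltW// truncnS_gt.
have [mt|tm] := leqP m (Num.truncn (rho / r)).+2.
  rewrite (big_cat_nat _ mt)//= [X in _ + X]big1_seq ?addr0// => n.
  rewrite mem_index_iota => /andP[_ /andP[mn _]]; apply: bump_eq0.
  by apply: (le_trans h); rewrite ler_nat.
rewrite [in RHS](big_cat_nat _ (ltnW tm))//= [X in _ = _ + X]big1_seq ?addr0// => n.
rewrite mem_index_iota => /andP[_ /andP[mn _]]; apply: bump_eq0.
by apply: (le_trans h2); rewrite ler_nat.
Qed.

(** The n-th bump is a continuous function of r that is at least k n where
n r <= rho and vanishes where rho / r <= n - 1; near each r > 0 only finitely
many bumps are nonzero, so their sum is continuous. The term 4 / r makes the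
cones of slope kappa narrow enough. *)
Lemma continuous_majorant : exists kappa : R -> R,
  [/\ forall r : R, 0 < r -> {for r, continuous kappa},
      forall r : R, 0 < r -> 4 / r <= kappa r &
      forall n r, 0 < r -> n%:R * r <= rho -> k n <= kappa r].
Proof.
exists (fun r => 4 / r + \sum_(0 <= n < (Num.truncn (rho / r)).+2) bump n r).
have s0 m r : 0 <= \sum_(0 <= n < m) bump n r by apply: sumr_ge0.
split=> [r r0|r r0|n r r0 nr].
- pose m := (Num.truncn (2 * rho / r + 1)).+1.
  pose g s := 4 / s + \sum_(0 <= n < m) bump n s.
  have cg : {for r, continuous g}.
    have cV : {for r, continuous (fun s : R => s^-1)}.
      by apply: continuousV; [rewrite gt_eqF|].
    apply: continuousD; first by apply: continuousM => //; exact: cst_continuous.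
    rewrite (_ : (fun s => _) = fun s => \sum_(n < m) bump n s); last first.
      by apply/funext => s; rewrite big_mkord.
    apply: continuous_sumr => n.
    apply: continuousM; first exact: cst_continuous.
    apply: continuous_maxr0.
    apply: continuousD; last exact: cst_continuous.
    apply: continuousB; last exact: cst_continuous.
    by apply: continuousM => //; exact: cst_continuous.
  have ge : \forall s \near r, g s = 4 / s + \sum_(0 <= n < (Num.truncn (rho / s)).+2) bump n s.
    have : \forall s \near r, r / 2 < s by apply: lt_nbhsr; lra.
    apply: filterS => s rs; rewrite (@bump_sum m)//.
    apply: (@le_trans _ _ (2 * rho / r + 1)); last by rewrite ltW// truncnS_gt.
    have s1 : 0 < s by lra.
    rewrite lerD2r ler_pdivrMr// mulrAC ler_pdivlMr//.
    by have := ler_wpM2l (ltW rho0) (ltW rs); lra.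
  have /= gr := nbhs_singleton ge.
  rewrite /prop_for /continuous_at -gr.
  apply: (@cvg_trans _ (g s @[s --> r])); last exact: cg.
  by apply: (@near_eq_cvg _ _ (nbhs r)).
- by rewrite lerDl.
- rewrite (@le_trans _ _ (bump n r))//.
    rewrite /bump ler_peMr// le_max; apply/orP; right.
    by rewrite -ler_pdivlMr// in nr; lra.
  have r4 : 0 <= 4 / r by rewrite divr_ge0// ltW.
  apply: ler_wpDl => //.
  have nt : (n < (Num.truncn (rho / r)).+2)%N.
    have d0 : 0 <= rho / r by rewrite divr_ge0// ltW.
    by rewrite ltnS ltnW// ltnS truncn_ge_nat// ler_pdivlMr.
  by rewrite big_mkord (bigD1 (Ordinal nt)) //= lerDl; apply: sumr_ge0.
Qed.

End continuous_majorant.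

Section usc_approximation.
Variables (R : realType) (rho : R) (f w : R -> R).
Local Notation mu := (@lebesgue_measure R).
Hypothesis rho0 : 0 < rho.
Hypothesis f0 : forall r : R, 0 < r < rho -> 0 <= f r.
Hypothesis fb : forall a : R, 0 < a -> exists2 M : R, 0 < M & forall r : R, a < r < rho -> f r <= M.
Hypothesis fusc : forall r y : R, 0 < r < rho -> f r < y -> \forall s \near r, f s < y.
Hypothesis w0 : forall r : R, 0 < r < rho -> 0 <= w r.
Hypothesis wb : forall a : R, 0 < a -> exists2 M : R, 0 < M & forall r : R, a < r < rho -> w r <= M.
Hypothesis cw : forall r : R, 0 < r < rho -> {for r, continuous w}.

Lemma usc_measurable : measurable_fun `]0, rho[%classic f.
Proof.
move=> mD; apply: (measurability _ (RGenInftyO.measurableE R)) => //.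
move=> _ [_ [y ->] <-]; apply: open_measurable; rewrite openE => r [/= + fy].
rewrite in_itv/= => rr; apply: filterI.
  by apply: near_in_itvoo; rewrite in_itv.
have := fusc rr; rewrite in_itv/= in fy => /(_ _ fy); apply: filterS => s /=.
by rewrite in_itv.
Qed.

Let J n : set R := `]0, rho[%classic `&`
  ([set x | n%:R * x <= rho] `&` [set x | rho < n.+1%:R * x]).

Let mJ n : measurable (J n).
Proof.
apply: measurableI => //; apply: measurableI.
  rewrite (_ : [set x | _] = ( *%R n%:R) @^-1` `]-oo, rho]%classic); last first.
    by apply/seteqP; split => x /=; rewrite in_itv.
  by rewrite -[X in measurable X]setTI; apply: mulrl_measurable.
rewrite (_ : [set x | _] = ( *%R n.+1%:R) @^-1` `]rho, +oo[%classic); last first.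
  by apply/seteqP; split => x /=; rewrite in_itv/= andbT.
by rewrite -[X in measurable X]setTI; apply: mulrl_measurable.
Qed.

Let JE : `]0, rho[%classic = \bigcup_n J n.
Proof.
apply/seteqP; split => x; last by move=> [n _ []].
move=> xr; exists (Num.truncn (rho / x)) => //; split => //.
move: xr; rewrite /= in_itv/= => /andP[x0 xr].
have d0 : 0 <= rho / x by rewrite divr_ge0// ltW.
by have /andP[h1 h2] := truncn_itv d0; split; rewrite -?ler_pdivlMr -?ltr_pdivrMr.
Qed.

Let tJ : trivIset setT J.
Proof.
suff E n x : J n x -> n = Num.truncn (rho / x).
  by move=> i j _ _ [x [/E -> /E ->]].
move=> [/=]; rewrite in_itv/= => /andP[x0 xr] [h1 h2].
have d0 : 0 <= rho / x by rewrite divr_ge0// ltW.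
apply/eqP; rewrite eqn_leq truncn_ge_nat// ler_pdivlMr// h1/=.
by rewrite truncn_le_nat ltr_pdivrMr.
Qed.

Let Jle n : mu (J n) \is a fin_num.
Proof.
rewrite ge0_fin_numE//; apply: (@le_lt_trans _ _ (mu `]0, rho[%classic)).
  by apply: le_measure; [rewrite inE; exact: mJ|rewrite inE|exact: subIsetl].
by rewrite lebesgue_measure_itv/= lte_fin rho0 -EFinB ltry.
Qed.

Let mwf (h : R -> R) A : measurable A -> A `<=` `]0, rho[%classic -> measurable_fun A h ->
  measurable_fun A (fun r => w r * (h r - f r)).
Proof.
move=> mA AD mh.
apply: measurable_funM.
  apply: (measurable_funS (E := `]0, rho[%classic)) => //.
  apply: open_continuous_measurable_fun; first exact: interval_open.
  by move=> x; rewrite inE/= in_itv/=; exact: cw.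
apply: measurable_funB => //.
by apply: (measurable_funS (E := `]0, rho[%classic)) => //; exact: usc_measurable.
Qed.

Let select n : exists k, [/\ 4 / rho * n.+1%:R <= k,
  measurable_fun (J n) (fun r => (w r * (supconv rho f k r - f r))%:E) &
  (\int[mu]_(r in J n) (w r * (supconv rho f k r - f r))%:E <= (1 / (2 ^ n.+1)%:R)%:E)%E].
Proof.
pose k0 := 4 / rho * n.+1%:R : R.
have k00 : 0 <= k0 by rewrite mulr_ge0// divr_ge0// ltW.
pose a := rho / n.+1%:R.
have a0 : 0 < a by rewrite divr_gt0.
have a20 : 0 < a / 2 by rewrite divr_gt0.
have k0a : k0 = 4 / a by rewrite /k0 /a invf_div mulrA mulrAC.
have Ja r : J n r -> a < r < rho.
  move=> [/=]; rewrite in_itv/= => /andP[x0 xr] [h1 h2].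
  by rewrite xr andbT /a ltr_pdivrMr// mulrC.
have J0 r : J n r -> 0 < r < rho.
  by move=> /Ja /andP[h1 ->]; rewrite andbT (lt_trans a0).
have k2 r k : a / 2 < r -> k0 <= k -> 2 / r <= k.
  move=> h1; apply: le_trans; rewrite k0a.
  have r0 : 0 < r by lra.
  by rewrite ler_pdivrMr// mulrAC ler_pdivlMr//; lra.
have k2' r k : J n r -> k0 <= k -> 2 / r <= k.
  by move=> /Ja /andP[h1 h2]; apply: k2; lra.
have [Mf Mf0 fM] := fb a20.
have [Mw Mw0 wM] := wb a0.
pose g m r := (w r * (supconv rho f (k0 + m%:R) r - f r))%:E.
have g0 m r : J n r -> 0 <= w r * (supconv rho f (k0 + m%:R) r - f r).
  move=> Jr; rewrite mulr_ge0 ?w0 ?subr_ge0//; first exact: J0.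
  by apply: supconv_ge => //; [exact: J0|apply: k2'; rewrite ?lerDl].
have gM m r : J n r -> w r * (supconv rho f (k0 + m%:R) r - f r) <= Mw * Mf.
  move=> Jr; apply: ler_pM.
  - by apply: w0; exact: J0.
  - rewrite subr_ge0; apply: supconv_ge => //; [exact: J0|apply: k2'; rewrite ?lerDl//].
  - by apply: wM; exact: Ja.
  - have h1 := f0 (J0 _ Jr).
    suff : supconv rho f (k0 + m%:R) r <= Mf by lra.
    apply: (supconv_bound f0 a0 (Ja _ Jr) _ fM (ltW Mf0)).
    apply: (@le_trans _ _ k0); last by rewrite lerDl.
    by rewrite k0a ler_pM2r ?invr_gt0// ler_nat.
have mg m : measurable_fun (J n) (g m).
  apply/measurable_EFinP; apply: mwf; [exact: mJ|exact: subIsetl|].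
  apply: (measurable_funS (E := `]a / 2, rho[%classic)) => //.
    by move=> x /Ja /andP[h1 h2]; rewrite /= in_itv/= h2 andbT; lra.
  apply: open_continuous_measurable_fun; first exact: interval_open.
  move=> x; rewrite inE/= in_itv/= => /andP[h1 h2].
  apply: (@supconv_continuous R rho f _ _ _ (cst (k0 + m%:R))) => //.
  - by rewrite h2 andbT; lra.
  - exact: cst_continuous.
  - have : \forall s \near x, a / 2 < s by apply: lt_nbhsr.
    by apply: filterS => s h; apply: k2; rewrite ?lerDl.
have cvg0 r : J n r -> g ^~ r @ \oo --> 0%E.
  move=> Jr; apply: cvg_EFin; first by apply: nearW.
  apply/cvgrPdist_le => e e0.
  have wp : 0 < w r + 1 by rewrite ltr_wpDl// w0//; exact: J0.
  have ep : 0 < e / (w r + 1) by rewrite divr_gt0.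
  have [|k1 k10 k1P] := @supconv_cvg R rho f f0 fusc r (f r + e / (w r + 1)) (J0 _ Jr).
    by rewrite ltrDl.
  near=> m.
  have h1 : supconv rho f (k0 + m%:R) r <= f r + e / (w r + 1).
    apply: k1P; rewrite ler_wpDl//; near: m; exact: nbhs_infty_ger.
  rewrite sub0r normrN ger0_norm ?g0//.
  have w1 : 0 <= w r by apply: w0; exact: J0.
  apply: (@le_trans _ _ (w r * (e / (w r + 1)))).
    by rewrite ler_wpM2l//; lra.
  rewrite mulrCA; apply: ler_piMr; first exact: ltW.
  by rewrite ler_pdivrMr// mul1r lerDl.
have aecvg : {ae mu, forall r : R, J n r -> g ^~ r @ \oo --> cst 0%E r}.
  by apply: aeW => r Jr; exact: cvg0.
have ig : mu.-integrable (J n) (cst (Mw * Mf)%:E).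
  apply/integrableP; split; first exact: measurable_cst.
  by rewrite integral_cst; [rewrite lte_mul_pinfty// ltey_eq Jle|exact: mJ].
have gdom : {ae mu, forall r m, J n r -> (`|g m r| <= cst (Mw * Mf)%:E r)%E}.
  by apply: aeW => r m Jr; rewrite /g lee_fin ger0_norm ?g0// gM.
have [_ _ c0] := @dominated_convergence _ _ _ mu (J n) (mJ n) g (cst 0%E) _ mg
  (measurable_cst _) aecvg ig gdom.
rewrite integral0 in c0.
have /fine_cvgP[nf /cvgrPdist_le] := c0.
have e0 : 0 < 1 / (2 ^ n.+1)%:R :> R by rewrite divr_gt0// ltr0n expn_gt0.
move=> /(_ _ e0) nd.
near \oo => m.
exists (k0 + m%:R); split; [by rewrite lerDl|exact: (mg m)|].
have fm : (\int[mu]_(r in J n) g m r)%E \is a fin_num by near: m.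
rewrite -/(g m) -[leLHS]fineK// lee_fin.
have : `|0 - fine (\int[mu]_(r in J n) g m r)%E| <= 1 / (2 ^ n.+1)%:R by near: m.
by rewrite sub0r normrN; apply: le_trans; rewrite ler_norm.
Unshelve. all: by end_near. Qed.

(** On the shell rho / (n + 1) < r <= rho / n (the set J n), bounded convergence
gives a slope for which the weighted error is at most 2^-(n + 1). A continuous
function kappa that dominates these slopes makes the errors on all shells at
least as small, because supconv decreases in the slope; they add up to at most
1. *)
Lemma usc_approximation : exists F : R -> R,
  [/\ forall r : R, 0 < r < rho -> {for r, continuous F},
      forall r : R, 0 < r < rho -> f r <= F r,
      measurable_fun `]0, rho[%classic (fun r => w r * (F r - f r)) &
      (\int[mu]_(r in `]0%R, rho[) (w r * (F r - f r))%:E <= 1)%E].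
Proof.
have /choice[k kP] := select.
have k0 n : 0 <= k n.
  have [kn _ _] := kP n; apply: (le_trans _ kn); rewrite mulr_ge0// divr_ge0//; exact: ltW.
have [kappa [ck k4 kn]] := continuous_majorant rho0 k0.
pose F r := supconv rho f (kappa r) r.
have k2 r : 0 < r -> 2 / r <= kappa r.
  by move=> r0; apply: le_trans (k4 _ r0); rewrite ler_pM2r ?invr_gt0// ler_nat.
have fF r : 0 < r < rho -> f r <= F r.
  by move=> /[dup] rr /andP[r0 _]; apply: supconv_ge => //; exact: k2.
have cF r : 0 < r < rho -> {for r, continuous F}.
  move=> /[dup] rr /andP[r0 _]; apply: supconv_continuous => //; first exact: ck.
  have : \forall s \near r, 0 < s by apply: lt_nbhsr.
  by apply: filterS => s; exact: k2.
have mF : measurable_fun `]0, rho[%classic (fun r => w r * (F r - f r)).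
  apply: mwf => //; apply: open_continuous_measurable_fun; first exact: interval_open.
  by move=> x; rewrite inE/= in_itv/=; exact: cF.
exists F; split => //.
have mE : measurable_fun (\bigcup_n J n) (fun r => (w r * (F r - f r))%:E).
  by rewrite -JE; apply/measurable_EFinP.
have ge0 r : 0 < r < rho -> (0 <= (w r * (F r - f r))%:E)%E.
  by move=> rr; rewrite lee_fin mulr_ge0 ?w0// subr_ge0 fF.
have J0 n r : J n r -> 0 < r < rho by move=> [/=]; rewrite in_itv.
rewrite JE ge0_integral_bigcup//; last first.
  by move=> r; rewrite -JE/= in_itv/=; exact: ge0.
apply: (le_trans _ (@epsilon_trick0 R 1 xpredT ler01)).
apply: lee_nneseries => [n _ _|n _].
  by apply: integral_ge0 => r Jr; apply: ge0; exact: J0 Jr.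
have [kn1 mkn] := kP n; apply: le_trans.
apply: ge0_le_integral => //.
- exact: mJ.
- by move=> r Jr; apply: ge0; exact: J0 Jr.
- apply: (measurable_funS _ _ mE); first exact: bigcup_measurable.
  by move=> x Jx; exists n.
- move=> r Jr; have /andP[r0 rr'] := J0 _ _ Jr; have [_ [nr rn]] := Jr.
  rewrite lee_fin; apply: ler_wpM2l; first by apply: w0; exact: J0 Jr.
  rewrite lerD2r; apply: supconv_anti => //; [exact: J0 Jr| |exact: kn].
  apply: (le_trans _ kn1).
  have h : 1 <= rho^-1 * n.+1%:R * r.
    by rewrite mulrAC -mulrA ler_pdivlMl// mulr1 mulrC ltW.
  by rewrite ler_pdivrMr//; lra.
Qed.

End usc_approximation.

(** * Calculus on an interval with left end 0 *)

Section antiderivative.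
Variables (R : realType) (rho : R) (h : R -> R).
Local Notation mu := (@lebesgue_measure R).
Hypothesis rho0 : 0 < rho.
Hypothesis ch : forall r : R, 0 < r < rho -> {for r, continuous h}.

Let int a b := \int[mu]_(x in `[a, b]) h x.

Let itv_integrable a b : 0 < a -> b < rho -> mu.-integrable `[a, b] (EFin \o h).
Proof.
move=> a0 br; apply: continuous_compact_integrable; first exact: segment_compact.
apply: continuous_in_subspaceT => x; rewrite inE/= in_itv/= => /andP[ax xb].
by apply: ch; rewrite (lt_le_trans a0)//= (le_lt_trans xb).
Qed.

Let int_cat a b c : 0 < a -> a <= b -> b <= c -> c < rho -> int a c = int a b + int b c.
Proof.
move=> a0 ab bc cr.
have := @Rintegral_itvB R h (BLeft a) (BRight c) b (itv_integrable a0 cr).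
rewrite !bnd_simp => /(_ ab bc).
have bo : mu.-integrable `]b, c] (EFin \o h).
  apply: integrableS (itv_integrable a0 cr) => //.
  by apply: subset_itvr; rewrite bnd_simp.
rewrite Rintegral_itv_obnd_cbnd; first by rewrite /int; lra.
by have /integrableP[/measurable_EFinP] := bo.
Qed.

(** The base point moves with r only to stay below r and below rho / 2; by H_eq
the value does not depend on it. *)
Let H r := int (Num.min r (rho / 2) / 2) r - int (Num.min r (rho / 2) / 2) (rho / 2).

Let H_eq a r : 0 < a -> a <= Num.min r (rho / 2) -> r < rho ->
  H r = int a r - int a (rho / 2).
Proof.
move=> a0; rewrite le_min => /andP[ar ac] rr; rewrite /H.
set m := Num.min r (rho / 2).
have m0 : 0 < m by rewrite lt_min (lt_le_trans a0 ar)//= (lt_le_trans a0 ac).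
have mr : m <= r by rewrite ge_min lexx.
have mc : m <= rho / 2 by rewrite ge_min lexx orbT.
have [am|ma] := leP a (m / 2).
  rewrite (@int_cat a (m / 2) r)//; last by lra.
  by rewrite (@int_cat a (m / 2) (rho / 2))//; lra.
rewrite (@int_cat (m / 2) a r)//; try lra.
by rewrite (@int_cat (m / 2) a (rho / 2))//; lra.
Qed.

Lemma antiderivative : exists F : R -> R,
  forall r : R, 0 < r < rho -> is_derive r 1 F (h r).
Proof.
exists H => r /[dup] rr /andP[r0 rr'].
pose a := Num.min r (rho / 2) / 2.
have a0 : 0 < a by rewrite divr_gt0// lt_min r0 divr_gt0.
have ar : a < r by rewrite /a ltr_pdivrMr// gt_min; apply/orP; left; lra.
have ac : a <= rho / 2.
  by rewrite /a ler_pdivrMr// ge_min; apply/orP; right; lra.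
pose u := (r + rho) / 2.
have ru : r < u by rewrite /u; lra.
have ur : u < rho by rewrite /u; lra.
have [d1 d2] := continuous_FTC1_closed ru (itv_integrable a0 ur) ar (ch rr).
apply: (@near_eq_is_derive _ _ _ (fun x => int a x - int a (rho / 2))).
  have : \forall s \near r, s \in `]a, rho[ by apply: near_in_itvoo; rewrite in_itv/= ar.
  apply: filterS => s; rewrite in_itv/= => /andP[as_ sr]; rewrite (@H_eq a)//.
  by rewrite le_min (ltW as_).
have d : is_derive r 1 (int a) (h r).
  by apply: DeriveDef; [exact: d1|rewrite -derive1E d2].
by have := is_deriveB d (is_derive_cst (int a (rho / 2)) r 1); rewrite subr0.
Qed.

End antiderivative.

Section monotone.
Variables (R : realType) (rho : R).

Lemma is_derive_continuous (f : R -> R) (df r : R) : is_derive r 1 f df ->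
  {for r, continuous f}.
Proof. by move=> [d _]; apply: differentiable_continuous; apply/derivable1_diffP. Qed.

Lemma integral_derive (F h : R -> R) (a b : R) :
  (forall r : R, 0 < r < rho -> {for r, continuous h}) ->
  (forall r : R, 0 < r < rho -> is_derive r 1 F (h r)) ->
  0 < a -> a < b -> b < rho ->
  (\int[@lebesgue_measure R]_(x in `[a, b]) (h x)%:E = (F b - F a)%:E)%E.
Proof.
move=> ch dF a0 ab br.
have sub x : a <= x <= b -> 0 < x < rho.
  by move=> /andP[ax xb]; rewrite (lt_le_trans a0 ax) (le_lt_trans xb br).
rewrite (@continuous_FTC2 R h F a b ab) ?EFinB//.
- apply: continuous_in_subspaceT => x; rewrite inE/= in_itv/= => xab.
  by apply: ch; exact: sub.
- split=> [x||].
  + rewrite in_itv/= => /andP[ax xb].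
    have xr : 0 < x < rho by apply: sub; rewrite !ltW.
    by have [] := dF x xr.
  + apply: cvg_at_right_filter; apply: is_derive_continuous.
    by apply: dF; apply: sub; rewrite lexx ltW.
  + apply: cvg_at_left_filter; apply: is_derive_continuous.
    by apply: dF; apply: sub; rewrite lexx ltW.
- move=> x; rewrite in_itv/= => /andP[ax xb].
  have xr : 0 < x < rho by apply: sub; rewrite !ltW.
  have [_ h1] := dF x xr.
  by rewrite derive1E h1.
Qed.

Lemma derive_MVT (f df : R -> R) : (forall r : R, 0 < r < rho -> is_derive r 1 f (df r)) ->
  forall x y : R, 0 < x -> x < y -> y < rho ->
  exists2 z, x < z < y & f y - f x = df z * (y - x).
Proof.
move=> d x y x0 xy yr.
have sub z : x <= z <= y -> 0 < z < rho.
  by move=> /andP[h1 h2]; rewrite (lt_le_trans x0 h1) (le_lt_trans h2 yr).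
have [||z zxy e] := @MVT R f df x y xy.
- move=> z; rewrite in_itv/= => /andP[h1 h2]; apply: d; apply: sub.
  by rewrite !ltW.
- apply: derivable_within_continuous => z; rewrite in_itv/= => h.
  by have [] := d z (sub z h).
by exists z.
Qed.

Lemma derive_le0_nincr (f df : R -> R) :
  (forall r : R, 0 < r < rho -> is_derive r 1 f (df r)) ->
  (forall r : R, 0 < r < rho -> df r <= 0) ->
  forall x y : R, 0 < x -> x <= y -> y < rho -> f y <= f x.
Proof.
move=> d d0 x y x0; rewrite le_eqVlt => /predU1P[->//|xy] yr.
have [z /andP[z1 z2] e] := derive_MVT d x0 xy yr.
rewrite -subr_le0 e mulr_le0_ge0 ?subr_ge0 ?(ltW xy)//.
by apply: d0; rewrite (lt_trans x0 z1) (lt_trans z2 yr).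
Qed.

(** Between r and rho / 2 the increment of FH is an integral of h, hence at most I. *)
Lemma antiderivative_lb (h FH : R -> R) (I : R) : 0 < rho ->
  (forall r : R, 0 < r < rho -> {for r, continuous h}) ->
  (forall r : R, 0 < r < rho -> 0 <= h r) ->
  (forall r : R, 0 < r < rho -> is_derive r 1 FH (h r)) ->
  (\int[@lebesgue_measure R]_(r in `]0%R, rho[) (h r)%:E <= I%:E)%E ->
  exists L, forall r : R, 0 < r < rho -> L <= FH r.
Proof.
move=> rho0 ch h0 dFH hI.
have mono x z : 0 < x -> x <= z -> z < rho -> FH x <= FH z.
  move=> x0 xz zr; rewrite -lerN2.
  apply: (@derive_le0_nincr (- FH) (fun r => - h r)) => // r rr.
    by apply: is_deriveN; exact: dFH.
  by rewrite oppr_le0 h0.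
pose c := rho / 2; have c0 : 0 < c by rewrite divr_gt0.
have cr : c < rho by rewrite /c; lra.
have I0 : 0 <= I.
  rewrite -lee_fin; apply: le_trans hI; apply: integral_ge0 => r.
  by rewrite /= in_itv/= => rr; rewrite lee_fin h0.
exists (FH c - I) => r /andP[r0 rr].
have [rc|cr'] := ltP r c; last first.
  by apply: (@le_trans _ _ (FH c)); [rewrite gerBl|exact: mono].
have := integral_derive ch dFH r0 rc cr.
have : (\int[@lebesgue_measure R]_(x in `[r, c]) (h x)%:E <= I%:E)%E.
  apply: (le_trans _ hI); apply: ge0_subset_integral => //.
  - apply/measurable_EFinP; apply: open_continuous_measurable_fun; first exact: interval_open.
    by move=> x; rewrite inE/= in_itv/=; exact: ch.
  - move=> x; rewrite /= !in_itv/= => /andP[rx xc].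
    by rewrite (lt_le_trans r0 rx) (le_lt_trans xc cr).
by move=> hh E1; move: hh; rewrite E1 lee_fin; lra.
Qed.

End monotone.

Lemma is_derive_ext (R : numFieldType) (V W : normedModType R) (f g : V -> W) (x v : V)
  (df dg : W) : is_derive x v f df -> f =1 g -> df = dg -> is_derive x v g dg.
Proof. by move=> h /funext <- <-. Qed.

(** * The ordinary differential inequality with continuous data *)

Section radial_subsolution.
Variables (R : realType) (rho eps p : R) (e t FE FH : R -> R).
Hypothesis rho0 : 0 < rho.
Hypothesis eps0 : 0 < eps.
Hypothesis p1 : 1 < p.
Hypothesis ce : forall r : R, 0 < r < rho -> {for r, continuous e}.
Hypothesis ct : forall r : R, 0 < r < rho -> {for r, continuous t}.
Hypothesis e_gt2 : forall r : R, 0 < r < rho -> 2 + eps <= e r.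
Hypothesis t0 : forall r : R, 0 < r < rho -> 0 <= t r.
Hypothesis dFE : forall r : R, 0 < r < rho -> is_derive r 1 FE (e r / r).

Let M r := expR (- FE r).
Let h r := t r * M r `^ (p - 1) * r `^ (2 * p - 1).

Hypothesis dFH : forall r : R, 0 < r < rho -> is_derive r 1 FH (h r).
Hypothesis FH_lb : exists L, forall r : R, 0 < r < rho -> L <= FH r.

Let M0 r : 0 < M r. Proof. exact: expR_gt0. Qed.

Let dM r : 0 < r < rho -> is_derive r 1 M (- (e r / r) * M r).
Proof.
move=> rr; have d1 := is_deriveN (dFE rr).
have := @is_derive1_comp R expR (- FE) r _ _ (is_derive_expR _) d1.
by move=> /is_derive_ext; apply => //; rewrite mulrC.
Qed.

Let h0 r : 0 < r < rho -> 0 <= h r.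
Proof. by move=> rr; rewrite !mulr_ge0 ?powR_ge0// t0. Qed.

Let cM r : 0 < r < rho -> {for r, continuous M}.
Proof. by move=> /dM; exact: is_derive_continuous. Qed.

Lemma continuous_powR_gt0 (a r : R) : 0 < r -> {for r, continuous (fun s => s `^ a)}.
Proof. by move=> r0; apply: (is_derive_continuous (is_derive1_powR a r0)). Qed.

Let ch r : 0 < r < rho -> {for r, continuous h}.
Proof.
move=> /[dup] rr /andP[r0 _]; apply: continuousM; last exact: continuous_powR_gt0.
apply: continuousM; first exact: ct.
apply: (@continuous_comp _ _ _ M (fun s => s `^ (p - 1))); first exact: cM.
exact: continuous_powR_gt0.
Qed.

Lemma is_derive_sqr (r : R) : is_derive r 1 (fun s : R => s ^+ 2) (2 * r).
Proof.
have := is_deriveX 2 (is_derive_id r (1 : R)); move=> /is_derive_ext; apply => //.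
by rewrite /= expr1 scaler1 -mulr_natl.
Qed.

Let dMr2 r : 0 < r < rho -> is_derive r 1 (fun s => M s * s ^+ 2) ((2 - e r) * (M r * r)).
Proof.
move=> /[dup] rr /andP[r0 _].
have := is_deriveM (dM rr) (is_derive_sqr r).
by move=> /is_derive_ext; apply => //; rewrite /GRing.scale/=; field; rewrite gt_eqF.
Qed.

(** M = exp (- FE) satisfies r M' = - e M, and W is chosen with W' = - C h, so that
- r G' - G e = C r M h = C t (M r^2)^p for G = M W. Where 1 <= W <= 2 and
e >= 2 + eps, the derivative of (2 / eps) M r^2 is at most - 2 M r, hence at most
U' = - r G; integrating from the point where U vanishes gives
U <= (2 / eps) M r^2, and C = (2 / eps)^p is the constant that this bound
requires. As M r^2 is nonincreasing, U' is at most a negative multiple of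
1 / r, and U is bounded below by a logarithm. *)
Lemma radial_subsolution : exists rho' (U G dG : R -> R),
  [/\ 0 < rho' < rho,
      forall r : R, 0 < r < rho' -> [/\ is_derive r 1 U (- r * G r), is_derive r 1 G (dG r),
        {for r, continuous dG}, 0 < U r & 0 < G r],
      forall r : R, 0 < r < rho' -> t r * U r `^ p <= - (r * dG r) - G r * e r &
      forall A : R, exists2 d : R, 0 < d & forall r : R, 0 < r < d -> A <= U r].
Proof.
pose C := (2 / eps) `^ p.
have C0 : 0 < C by rewrite powR_gt0// divr_gt0.
have FHm x y : 0 < x -> x <= y -> y < rho -> FH x <= FH y.
  move=> x0 xy yr; rewrite -lerN2.
  apply: (@derive_le0_nincr R rho (- FH) (fun r => - h r)) => // r rr.
    by apply: is_deriveN; exact: dFH.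
  by rewrite oppr_le0 h0.
have [L LP] := FH_lb.
pose E := [set FH r | r in `]0, rho[%classic].
have E0 : E !=set0.
  exists (FH (rho / 2)); exists (rho / 2) => //=.
  by rewrite in_itv/= divr_gt0//= ltr_pdivrMr// ltr_pMr// ltr1n.
have Elb : has_lbound E.
  by exists L => _ [r /= + <-]; rewrite in_itv/=; exact: LP.
(* rho' is so close to 0 that the total variation of FH below it is at most 1 / C,
   which keeps W at most 2. *)
have [_ [rho' /= + <-] FHr'] : exists2 z, E z & z < inf E + C^-1.
  by apply: inf_adherent; rewrite ?invr_gt0.
rewrite in_itv/= => /[dup] rr' /andP[r'0 r'r].
have infFH r : 0 < r < rho -> inf E <= FH r.
  by move=> rr; apply: ge_inf => //; exists r => //=; rewrite in_itv.
pose W r := 1 + C * (FH rho' - FH r).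
have dW r : 0 < r < rho -> is_derive r 1 W (- C * h r).
  move=> rr.
  have := is_deriveD (is_derive_cst (1 : R) r 1)
    (is_deriveZ C (is_deriveB (is_derive_cst (FH rho') r 1) (dFH rr))).
  by move=> /is_derive_ext; apply => //; rewrite add0r sub0r /GRing.scale/= mulrN mulNr.
have W1 r : 0 < r <= rho' -> 1 <= W r.
  move=> /andP[r0 rr]; rewrite lerDl mulr_ge0 ?subr_ge0 ?(ltW C0)//.
  exact: FHm.
have W2 r : 0 < r < rho -> W r <= 2.
  move=> rr; suff : C * (FH rho' - FH r) <= 1 by rewrite /W; lra.
  by rewrite mulrC -ler_pdivlMr// mul1r; have := infFH _ rr; lra.
pose G r := M r * W r.
pose dG r := - (e r / r) * M r * W r - M r * (C * h r).
have dGP r : 0 < r < rho -> is_derive r 1 G (dG r).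
  move=> rr; have := is_deriveM (dM rr) (dW _ rr).
  by move=> /is_derive_ext; apply => //; rewrite /GRing.scale/= /dG; ring.
have cG r : 0 < r < rho -> {for r, continuous G}.
  by move=> /dGP; exact: is_derive_continuous.
have cW r : 0 < r < rho -> {for r, continuous W}.
  by move=> /dW; exact: is_derive_continuous.
have cdG r : 0 < r < rho -> {for r, continuous dG}.
  move=> /[dup] rr /andP[r0 _].
  have cV : {for r, continuous (fun s : R => s^-1)} by apply: continuousV => //; rewrite gt_eqF.
  apply: continuousB; last first.
    apply: continuousM; first exact: cM.
    by apply: continuousM; [exact: cst_continuous|exact: ch].
  apply: continuousM; last exact: cW.
  apply: continuousM; last exact: cM.
  apply: continuousN; apply: continuousM => //; exact: ce.
have [U0 dU0] : exists U0 : R -> R, forall r : R, 0 < r < rho -> is_derive r 1 U0 (- r * G r).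
  apply: antiderivative => // r rr; apply: continuousM; last exact: cG.
  exact: continuousN.
pose U r := U0 r - U0 rho'.
have dU r : 0 < r < rho -> is_derive r 1 U (- r * G r).
  move=> rr; have := is_deriveB (dU0 _ rr) (is_derive_cst (U0 rho') r 1).
  by rewrite subr0.
have Ur' : U rho' = 0 by rewrite /U subrr.
have lt_r r : 0 < r < rho' -> 0 < r < rho.
  by move=> /andP[-> h1]; rewrite (lt_trans h1).
have G0 r : 0 < r <= rho' -> 0 < G r.
  by move=> rr; rewrite mulr_gt0// (lt_le_trans ltr01)// W1.
have U_gt0 r : 0 < r < rho' -> 0 < U r.
  move=> /andP[r0 rr].
  have [z /andP[z1 z2]] := derive_MVT dU r0 rr r'r.
  rewrite Ur' => Uz.
  have Gz : 0 < G z by apply: G0; rewrite (lt_trans r0 z1) ltW.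
  have z0 : 0 < z by exact: lt_trans z1.
  have : 0 < z * G z * (rho' - r) by apply: mulr_gt0; [exact: mulr_gt0|rewrite subr_gt0].
  lra.
have U_le r : 0 < r < rho' -> U r <= 2 / eps * (M r * r ^+ 2).
  move=> /andP[r0 rr].
  pose phi s := 2 / eps * (M s * s ^+ 2) - U s.
  have dphi s : 0 < s < rho ->
      is_derive s 1 phi (2 / eps * ((2 - e s) * (M s * s)) + s * G s).
    move=> ss; have := is_deriveB (is_deriveZ (2 / eps) (dMr2 ss)) (dU _ ss).
    by move=> /is_derive_ext; apply => //; rewrite /GRing.scale/=; ring.
  have phi0 s : 0 < s < rho -> 2 / eps * ((2 - e s) * (M s * s)) + s * G s <= 0.
    move=> /[dup] ss /andP[s0 _].
    have -> : 2 / eps * ((2 - e s) * (M s * s)) + s * G s =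
       (M s * s) * (2 / eps * (2 - e s) + W s) by rewrite /G; ring.
    rewrite mulr_ge0_le0 ?(ltW (mulr_gt0 (M0 s) s0))//.
    have h1 : 2 / eps * (2 - e s) <= - 2.
      rewrite mulrAC ler_pdivrMr//; have := e_gt2 ss; lra.
    by have := W2 _ ss; lra.
  have := derive_le0_nincr dphi phi0 r0 (ltW rr) r'r.
  rewrite {1}/phi Ur' subr0 => h1.
  have : 0 <= 2 / eps * (M rho' * rho' ^+ 2).
    by rewrite mulr_ge0 ?divr_ge0 ?(ltW eps0)// mulr_ge0 ?sqr_ge0 ?(ltW (M0 _)).
  move: h1; rewrite /phi; lra.
exists rho', U, G, dG; split => //.
- move=> r rr; split; [exact/dU/lt_r|exact/dGP/lt_r|exact/cdG/lt_r|exact: U_gt0|].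
  by apply: G0; case/andP: rr => -> /ltW.
- move=> r /[dup] rr /andP[r0 _].
  have -> : - (r * dG r) - G r * e r = r * (M r * (C * h r)).
    by rewrite /dG /G; field; rewrite gt_eqF.
  have Mr0 : 0 <= M r * r ^+ 2 by rewrite mulr_ge0 ?sqr_ge0 ?ltW.
  (* r^(2p) = r r^(2p-1) and M^p = M M^(p-1) absorb the factor r M. *)
  have -> : r * (M r * (C * h r)) = t r * (2 / eps * (M r * r ^+ 2)) `^ p.
    rewrite (@powRM _ (2 / eps)) ?divr_ge0 ?(ltW eps0)//.
    rewrite (@powRM _ (M r)) ?sqr_ge0 ?(ltW (M0 _))// -/C.
    have -> : M r `^ p = M r * M r `^ (p - 1).
      rewrite -[X in X * _]powRr1 ?(ltW (M0 _))// -powRD ?subrKC//.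
      by apply/implyP => _; rewrite gt_eqF.
    have -> : (r ^+ 2) `^ p = r * r `^ (2 * p - 1).
      rewrite -[X in X * _]powRr1 ?(ltW r0)// -powRD ?subrKC; last first.
        by apply/implyP => _; rewrite gt_eqF.
      by rewrite powRrM powR_mulrn// ltW.
    by rewrite /h; ring.
  apply: ler_wpM2l; first by apply: t0; exact: lt_r.
  apply: ge0_ler_powR; rewrite ?nnegrE.
  + by apply: ltW; apply: lt_trans p1.
  + by apply: ltW; exact: U_gt0.
  + by rewrite mulr_ge0// divr_ge0// ltW.
  + exact: U_le.
- move=> A.
  pose m0 := M rho' * rho' ^+ 2.
  have m00 : 0 < m0 by rewrite mulr_gt0// exprn_gt0.
  have Mge r : 0 < r <= rho' -> m0 <= M r * r ^+ 2.
    move=> /andP[r0 rr]; apply: (derive_le0_nincr dMr2) => // s ss.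
    rewrite mulr_le0_ge0//; first by rewrite subr_le0 (le_trans _ (e_gt2 ss))// lerDl ltW.
    by rewrite mulr_ge0 ?(ltW (M0 _))//; case/andP: ss => /ltW.
  have psi r : 0 < r < rho' -> m0 * (ln rho' - ln r) <= U r.
    move=> /andP[r0 rr].
    pose psi s := U s + m0 * ln s.
    have dpsi s : 0 < s < rho -> is_derive s 1 psi (- s * G s + m0 * s^-1).
      move=> /[dup] ss /andP[s0 _].
      exact: is_deriveD (dU _ ss) (is_deriveZ m0 (is_derive1_ln s0)).
    have [z /andP[z1 z2]] := derive_MVT dpsi r0 rr r'r.
    have z0 : 0 < z by exact: lt_trans z1.
    have zr : 0 < z <= rho' by rewrite z0 ltW.
    rewrite /psi Ur' add0r => ez.
    have : (- z * G z + m0 / z) * (rho' - r) <= 0.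
      rewrite mulr_le0_ge0 ?subr_ge0 ?(ltW rr)//.
      have : m0 / z <= z * G z.
        rewrite ler_pdivrMr// (le_trans (Mge _ zr))//.
        have -> : z * G z * z = M z * z ^+ 2 * W z by rewrite /G; ring.
        by rewrite ler_peMr ?W1// mulr_ge0 ?sqr_ge0// ltW.
      lra.
    by rewrite -ez; lra.
  exists (Num.min rho' (rho' * expR (- (A / m0)))).
    by rewrite lt_min r'0 mulr_gt0// expR_gt0.
  move=> r /andP[r0]; rewrite lt_min => /andP[rr rA].
  apply: le_trans (psi r _); last by rewrite r0.
  rewrite mulrC -ler_pdivrMr//.
  have : ln r <= ln (rho' * expR (- (A / m0))).
    by rewrite ler_ln ?posrE// ?mulr_gt0 ?expR_gt0// ltW.
  rewrite lnM ?posrE ?expR_gt0// expRK; lra.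
Qed.

End radial_subsolution.

(** * The elliptic operator on functions of |g x| *)

Section directional_chain_rule.
Variables (R : realType) (V : normedModType R).

Lemma is_derive_line0 (f : V -> R) (x v : V) (df : R) :
  is_derive x v f df <-> is_derive (0 : R) 1 (fun h : R => f (x + h *: v)) df.
Proof.
have := is_derive_line f x v 0 df.
by rewrite scale0r addr0.
Qed.

Lemma is_derive_comp_real (s : V -> R) (F : R -> R) (x v : V) (a b : R) :
  is_derive x v s a -> is_derive (s x : R) 1 F b -> is_derive x v (F \o s) (b * a).
Proof.
move=> /is_derive_line0 ds dF; apply/is_derive_line0.
by apply: (@is_derive1_comp R F (fun h : R => s (x + h *: v))); rewrite ?scale0r ?addr0.
Qed.

End directional_chain_rule.

Section radial_functions.
Variables (R : realType) (n : nat) (g : 'M[R]_n).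
Local Notation vec := 'cV[R]_n.
Local Notation e i := (delta_mx i 0 : vec).
Let H := g^T *m g.
Let s (x : vec) := enorm (g *m x).

Lemma dotE (x y : vec) : dot x y = (x^T *m y) 0 0.
Proof. by rewrite mxE; apply: eq_bigr => i _; rewrite mxE. Qed.

Lemma dotC (x y : vec) : dot x y = dot y x.
Proof. by apply: eq_bigr => i _; rewrite mulrC. Qed.

Lemma dotDl (x y z : vec) : dot (x + y) z = dot x z + dot y z.
Proof. by rewrite -big_split/=; apply: eq_bigr => i _; rewrite mxE mulrDl. Qed.

Lemma dotZl (a : R) (x y : vec) : dot (a *: x) y = a * dot x y.
Proof. by rewrite /dot mulr_sumr; apply: eq_bigr => i _; rewrite mxE mulrA. Qed.

Lemma dot_sqrD (y z : vec) (h : R) :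
  dot (y + h *: z) (y + h *: z) = dot y y + 2 * h * dot z y + h ^+ 2 * dot z z.
Proof.
rewrite dotDl dotZl ![dot _ (y + _)]dotC !dotDl !dotZl (dotC y z).
by ring.
Qed.

Lemma dot_mulmx (M : 'M[R]_n) (x y : vec) : dot (M *m x) y = dot x (M^T *m y).
Proof. by rewrite !dotE trmx_mul mulmxA. Qed.

Lemma dot_delta (x : vec) i : dot (e i) x = x i 0.
Proof.
rewrite /dot (bigD1 i)//= big1 ?addr0; last first.
  by move=> j ji; rewrite mxE (negbTE ji) mul0r.
by rewrite mxE !eqxx mul1r.
Qed.

Lemma is_derive_linear_entry (M : 'M[R]_n) (x : vec) i j :
  is_derive x (e j) (fun x : vec => (M *m x) i 0) (M i j).
Proof.
apply/is_derive_line0.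
have : is_derive (0 : R) 1 (fun h : R => (M *m x) i 0 + h * M i j) (0 + M i j).
  have := is_deriveD (is_derive_cst ((M *m x) i 0) (0 : R) (1 : R))
    (is_deriveM (is_derive_id (0 : R) (1 : R)) (is_derive_cst (M i j) (0 : R) (1 : R))).
  by move=> /is_derive_ext; apply => //; rewrite /GRing.scale/= mul0r mulr1 !add0r.
move=> /is_derive_ext; apply; last by rewrite add0r.
move=> h; rewrite mulmxDr -scalemxAr [in RHS]mxE; congr (_ + _).
by rewrite [in RHS]mxE -colE; congr (_ * _); rewrite mxE.
Qed.

(** Along a coordinate line, |g x|^2 is a quadratic polynomial, positive at the base
point. *)
Lemma is_derive_enorm (x : vec) i : 0 < s x ->
  is_derive x (e i) s ((H *m x) i 0 / s x).
Proof.
move=> s0; apply/is_derive_line0.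
pose q (h : R) := s x ^+ 2 + (2 * (H *m x) i 0) * h + H i i * h ^+ 2.
have qE h : dot (g *m (x + h *: e i)) (g *m (x + h *: e i)) = q h.
  rewrite mulmxDr -scalemxAr dot_sqrD /q sqr_enorm.
  have -> : dot (g *m e i) (g *m x) = (H *m x) i 0.
    by rewrite dot_mulmx mulmxA dot_delta.
  have -> : dot (g *m e i) (g *m e i) = H i i.
    by rewrite dot_mulmx mulmxA dot_delta -colE mxE.
  by ring.
have dq : is_derive (0 : R) 1 q (2 * (H *m x) i 0).
  have := is_deriveD (is_deriveD (is_derive_cst (s x ^+ 2) (0 : R) (1 : R))
    (is_deriveZ (2 * (H *m x) i 0) (is_derive_id (0 : R) (1 : R))))
    (is_deriveZ (H i i) (is_derive_sqr (0 : R))).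
  by move=> /is_derive_ext; apply => //; rewrite /GRing.scale/=; ring.
have q0 : q 0 = s x ^+ 2 by rewrite /q; ring.
have q00 : 0 < q 0 by rewrite q0 exprn_gt0.
have := @is_derive1_comp R _ q 0 _ _ (is_derive1_powR 2^-1 q00) dq.
move=> /is_derive_ext; apply.
  move=> h /=; rewrite powR12_sqrt; last by rewrite -qE dot_ge0.
  by rewrite /s /enorm qE.
rewrite q0 powRB; last by apply/implyP => _; rewrite gt_eqF// exprn_gt0.
rewrite powR12_sqrt ?sqr_ge0// sqrtr_sqr gtr0_norm// powRr1 ?sqr_ge0//.
by field; rewrite gt_eqF.
Qed.

Variables (U G dG : R -> R) (rho : R).
Hypothesis dU : forall r : R, 0 < r < rho -> is_derive r 1 U (- r * G r).
Hypothesis dGP : forall r : R, 0 < r < rho -> is_derive r 1 G (dG r).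
Hypothesis cdG : forall r : R, 0 < r < rho -> {for r, continuous dG}.

Definition radial_fun (x : vec) : R := U (s x).
(** The gradient of |g x| is H x / |g x| with H = g^T g. Writing the derivative of U
as - r G cancels the denominator, and G plays the role of - U' / r in the second
derivatives. *)
Definition radial_fun1 i (x : vec) : R := - G (s x) * (H *m x) i 0.
Definition radial_fun2 i j (x : vec) : R :=
  - (dG (s x) * ((H *m x) j 0 / s x)) * (H *m x) i 0 - G (s x) * H i j.

Lemma radial_fun_derive i x : 0 < s x < rho -> is_derive x (e i) radial_fun (radial_fun1 i x).
Proof.
move=> /[dup] sx /andP[s0 _].
have := is_derive_comp_real (is_derive_enorm i s0) (dU sx).
by move=> /is_derive_ext; apply => //; rewrite /radial_fun1; field; rewrite gt_eqF.
Qed.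

Lemma radial_fun1_derive i j x : 0 < s x < rho ->
  is_derive x (e j) (radial_fun1 i) (radial_fun2 i j x).
Proof.
move=> /[dup] sx /andP[s0 _].
have d1 : is_derive x (e j) (fun x => - G (s x)) (- (dG (s x) * ((H *m x) j 0 / s x))).
  exact: is_deriveN (is_derive_comp_real (is_derive_enorm j s0) (dGP sx)).
have := is_deriveM d1 (is_derive_linear_entry H x i j).
move=> /is_derive_ext; apply => //; rewrite /radial_fun2 /GRing.scale/=.
by ring.
Qed.

Let cs : continuous s. Proof. exact: continuous_enorm_mulmx. Qed.

Lemma radial_fun_continuous x : 0 < s x < rho -> {for x, continuous radial_fun}.
Proof.
move=> sx; apply: continuous_comp; first exact: cs.
exact: is_derive_continuous (dU sx).
Qed.

Lemma radial_fun1_continuous i x : 0 < s x < rho -> {for x, continuous (radial_fun1 i)}.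
Proof.
move=> sx; apply: continuousM; last exact: continuous_mulmx_entry.
apply: continuousN; apply: continuous_comp; first exact: cs.
exact: is_derive_continuous (dGP sx).
Qed.

Lemma radial_fun2_continuous i j x : 0 < s x < rho -> {for x, continuous (radial_fun2 i j)}.
Proof.
move=> /[dup] sx /andP[s0 _]; apply: continuousB; last first.
  apply: continuousM; last exact: cst_continuous.
  apply: continuous_comp; first exact: cs.
  exact: is_derive_continuous (dGP sx).
apply: continuousM; last exact: continuous_mulmx_entry.
apply: continuousN; apply: continuousM.
  by apply: continuous_comp; [exact: cs|exact: cdG].
apply: continuousM; first exact: continuous_mulmx_entry.
by apply: continuousV; [rewrite gt_eqF|exact: cs].
Qed.

(** The part of the second derivatives that is a multiple of H contributes the trace
of a_g, the first derivatives contribute (b_g(y), y), and these two sums make up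
Psi. What remains is the quadratic form of a at H x, which is the one of a_g at
y = g x. *)
Lemma elliptic_op_radial (a : vec -> 'M[R]_n) (b : vec -> vec) (x : vec) :
  g \in unitmx -> 0 < s x -> radial_coef g a (g *m x) != 0 ->
  elliptic_op a b radial_fun1 radial_fun2 x =
  radial_coef g a (g *m x) * (- (s x * dG (s x)) - G (s x) * Psi g a b (g *m x)).
Proof.
move=> ug s0 A0.
have xE : invmx g *m (g *m x) = x by rewrite mulmxA mulVmx// mul1mx.
have HT : H^T = H by rewrite /H trmx_mul trmxK.
have Hs k l : H k l = H l k by rewrite -[in LHS]HT mxE.
rewrite mulrBr mulrCA /Psi [radial_coef _ _ _ * (_ / _)]mulrC divfK//.
have -> : radial_coef g a (g *m x) * - (s x * dG (s x)) =
    - (dG (s x) / s x) * dot (a x *m (H *m x)) (H *m x).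
  rewrite /radial_coef /conj_a xE -/(s x) -mulmxA -mulmxA dot_mulmx !mulmxA.
  rewrite -/H; move: (dot _ _) => d; field; by rewrite gt_eqF.
rewrite /elliptic_op /conj_a /conj_b xE.
have -> : \tr (g *m a x *m g^T) = \sum_i \sum_j a x i j * H i j.
  rewrite -mulmxA mxtrace_mulC -mulmxA -/H /mxtrace; apply: eq_bigr => i _.
  by rewrite mxE; apply: eq_bigr => j _; rewrite Hs.
have -> : dot (g *m b x) (g *m x) = \sum_i b x i 0 * (H *m x) i 0.
  by rewrite dot_mulmx mulmxA.
have -> : dot (a x *m (H *m x)) (H *m x) =
    \sum_i \sum_j a x i j * ((H *m x) i 0 * (H *m x) j 0).
  rewrite /dot; apply: eq_bigr => i _; rewrite mxE mulr_suml; apply: eq_bigr => j _.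
  by ring.
rewrite mulrDr opprD addrA; congr (_ + _); last first.
  rewrite mulr_sumr -sumrN; apply: eq_bigr => i _; rewrite /radial_fun1; ring.
rewrite !mulr_sumr -sumrN -big_split/=; apply: eq_bigr => i _.
rewrite !mulr_sumr -sumrN -big_split/=; apply: eq_bigr => j _.
by rewrite /radial_fun2; field; rewrite gt_eqF.
Qed.

End radial_functions.

(** * Bounds on the coefficients and on their envelopes *)

Section compactness.
Variables (R : realType) (n : nat).

Lemma continuous_trmx_rV : continuous (fun x : 'rV[R]_n => x^T).
Proof.
move=> x A /nbhs_ballP[e /= e0 eA].
have : nbhs x (ball x e) by exact: nbhsx_ballx.
apply: filterS => y [_ h]; apply: eA; split => // i j; rewrite !mxE; exact: h.
Qed.

Lemma closed_bounded_compact (C : set 'cV[R]_n) (B : R) : closed C -> C `<=` cube n B ->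
  compact C.
Proof.
move=> cC CB; pose C' := [set x : 'rV[R]_n | C x^T].
rewrite (_ : C = (fun x : 'rV[R]_n => x^T) @` C'); last first.
  apply/seteqP; split => [x Cx|_ [x Cx <-]//].
  by exists x^T; rewrite /C' /= trmxK.
apply: continuous_compact; first exact: continuous_subspaceT continuous_trmx_rV.
apply: bounded_closed_compact.
  exists `|B|; split; first exact: num_real.
  move=> b Bb x Cx /=; rewrite [leLHS]mx_normrE.
  apply: bigmax_le => [|[i j] _ /=]; first by apply: ltW; apply: le_lt_trans Bb.
  have := CB _ Cx j; rewrite mxE (ord1 i) -ler_norml => /le_trans; apply.
  by apply: (le_trans (ler_norm _)); exact: ltW.
by apply: closed_comp cC => x _; exact: continuous_trmx_rV.
Qed.

End compactness.

Section monotone_integral.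
Local Open Scope ereal_scope.

(** The integral of a nonnegative function is the supremum of the integrals of the
simple functions below it, hence monotone even on functions not known to be
measurable, such as the growth factor. *)
Lemma ge0_le_integral_nonmeas d (T : measurableType d) (R : realType)
    (mu : {measure set T -> \bar R}) (A B : set T) (f h : T -> \bar R) :
  A `<=` B -> (forall x, A x -> 0 <= f x) -> (forall x, B x -> 0 <= h x) ->
  (forall x, A x -> f x <= h x) ->
  \int[mu]_(x in A) f x <= \int[mu]_(x in B) h x.
Proof.
move=> AB f0 h0 fh; rewrite !ge0_integralE//.
apply: ereal_sup_le => _ [k /= kf <-]; exists k => //= x.
apply: (le_trans (kf x)); rewrite /patch; case: ifPn => xA.
  by rewrite mem_set; [apply: fh; rewrite inE in xA|apply: AB; rewrite inE in xA].
by case: ifPn => // xB; apply: h0; rewrite inE in xB.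
Qed.

End monotone_integral.

Section ae_bounds.
Variables (R : realType) (N : nat).
Hypothesis hN : (0 < N)%N.
Local Notation vec := 'cV[R]_N.
Local Notation mu := (lebesgue R N).
Variables (R0 : R) (a : vec -> 'M[R]_N) (b : vec -> vec) (K : vec -> R) (nu c : R).
Variables (g : 'M[R]_N) (R1 : R).
Hypothesis hnu : 1 < nu.
Hypothesis ha_ell : \forall x \ae mu, punctured_eball R0 x -> forall xi : vec,
  nu^-1 * enorm xi ^+ 2 <= \sum_i \sum_j a x i j * xi i 0 * xi j 0 <= nu * enorm xi ^+ 2.
Hypothesis hc : 0 < c.
Hypothesis hb_bound : forall i, \forall x \ae mu, punctured_eball R0 x -> `|b x i 0| <= c / enorm x.
Hypothesis hK : in_Lp_loc +oo%E (punctured_eball R0) K.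
Hypothesis hK_inf : (0 < ess_inf_on mu (eball R0) (EFin \o K))%E.
Hypothesis hg : g \in unitmx.
Hypothesis hR1_sub : [set x : vec | enorm x <= R1] `<=` (fun x => g *m x) @` eball R0.

Let pre (y : vec) := invmx g *m y.

Lemma preimage_in_ball y : 0 < enorm y <= R1 -> punctured_eball R0 (pre y).
Proof.
move=> /andP[y0 yR]; have [x xR gx] := hR1_sub yR.
rewrite /pre -gx mulmxA mulVmx// mul1mx; split => // x0.
by move: y0; rewrite -gx x0 mulmx0 enorm0 ltxx.
Qed.

Lemma quadratic_formE (A : 'M[R]_N) (xi : vec) :
  \sum_i \sum_j A i j * xi i 0 * xi j 0 = dot (A *m xi) xi.
Proof.
rewrite /dot; apply: eq_bigr => i _; rewrite mxE mulr_suml; apply: eq_bigr => j _.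
by rewrite mulrAC.
Qed.

(** The drift is bounded by c / |x| but enters through its product with y = g x,
whose norm is comparable to |x|. *)
Lemma ae_coef_bounds : exists amin C : R, [/\ 0 < amin, 0 < C &
  \forall y \ae mu, 0 < enorm y <= R1 -> amin <= radial_coef g a y /\ `|Psi g a b y| <= C].
Proof.
have nu0 : 0 < nu by exact: lt_trans hnu.
have ugT : g^T \in unitmx by rewrite unitmx_tr.
have [C1 C10 C1P] := enorm_mulmx_le g^T.
have [c1 c10 c1P] := enorm_mulmx_ge ugT.
have [C2 C20 C2P] := enorm_mulmx_le g.
pose amin := nu^-1 * c1 ^+ 2.
have amin0 : 0 < amin by rewrite mulr_gt0 ?invr_gt0// exprn_gt0.
pose T0 := \sum_(i < N) nu * (C1 * enorm (delta_mx i 0 : vec)) ^+ 2.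
pose B0 := \sum_(i < N) c * (C2 * C1).
have T00 : 0 <= T0 by apply: sumr_ge0 => i _; rewrite mulr_ge0 ?sqr_ge0 ?ltW.
have B00 : 0 <= B0 by apply: sumr_ge0 => i _; rewrite !mulr_ge0 ?ltW.
exists amin, (1 + (T0 + B0) / amin); split => //.
  by rewrite ltr_pwDl// divr_ge0 ?addr_ge0// ltW.
have hb' : \forall x \ae mu, forall i, punctured_eball R0 x -> `|b x i 0| <= c / enorm x.
  have h : \forall x \ae mu, forall k : nat, (if insub k is Some i then
      (punctured_eball R0 x -> `|b x i 0| <= c / enorm x) else True).
    apply: ae_foralln => k; case: insubP => [i _ _|_]; last by apply: aeW.
    exact: hb_bound.
  by apply: filterS h => x h i; have := h (val i); rewrite valK.
have ui : invmx g \in unitmx by rewrite unitmx_inv.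
have h1 := ae_mulmx ui ha_ell; have h2 := ae_mulmx ui hb'.
apply: filterS2 h1 h2 => y /= ell bb /[dup] yR /andP[y0 _].
have pb := preimage_in_ball yR.
have {}ell := ell pb.
have qf xi : dot (conj_a g a y *m xi) xi = dot (a (pre y) *m (g^T *m xi)) (g^T *m xi).
  by rewrite /conj_a -/(pre y) -!mulmxA dot_mulmx !mulmxA.
have y2 : 0 < enorm y ^+ 2 by rewrite exprn_gt0.
have rc : amin <= radial_coef g a y.
  rewrite /radial_coef ler_pdivlMr// qf -quadratic_formE.
  have /andP[h _] := ell (g^T *m y); apply: le_trans h.
  rewrite /amin -mulrA ler_wpM2l ?invr_ge0 ?(ltW nu0)// -exprMn.
  by rewrite lerXn2r ?nnegrE ?mulr_ge0 ?enorm_ge0// ltW.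
split => //.
have rc0 : 0 < radial_coef g a y by exact: lt_le_trans rc.
have trb : `|\tr (conj_a g a y)| <= T0.
  rewrite /mxtrace (le_trans (ler_norm_sum _ _ _))//; apply: ler_sum => i _.
  have -> : conj_a g a y i i = dot (conj_a g a y *m delta_mx i 0) (delta_mx i 0).
    by rewrite dotC dot_delta -colE [in RHS]mxE.
  rewrite qf -quadratic_formE.
  have /andP[h1 h2] := ell (g^T *m delta_mx i 0).
  rewrite ger0_norm; last by apply: le_trans h1; rewrite mulr_ge0 ?sqr_ge0// invr_ge0 ltW.
  apply: (le_trans h2); rewrite ler_wpM2l ?(ltW nu0)//.
  by rewrite lerXn2r ?nnegrE ?mulr_ge0 ?enorm_ge0// ltW.
have x0 : 0 < enorm (pre y) by apply: enorm_gt0; case: pb.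
have yx : enorm y <= C2 * enorm (pre y).
  by have := C2P (pre y); rewrite mulmxA mulmxV// mul1mx.
have bbd : `|dot (conj_b g b y) y| <= B0.
  rewrite /conj_b -/(pre y) dot_mulmx /dot (le_trans (ler_norm_sum _ _ _))//.
  apply: ler_sum => i _; rewrite normrM.
  have h1 := bb i pb; have h2 := le_trans (coord_le_enorm (g^T *m y) i) (C1P y).
  apply: (@le_trans _ _ (c / enorm (pre y) * (C1 * (C2 * enorm (pre y))))).
    apply: ler_pM => //; apply: (le_trans h2); rewrite ler_wpM2l// ltW//.
  by rewrite le_eqVlt; apply/orP; left; apply/eqP; field; rewrite gt_eqF.
rewrite /Psi normrM normfV (gtr0_norm rc0) ler_pdivrMr//.
apply: (@le_trans _ _ (T0 + B0)); first by rewrite (le_trans (ler_normD _ _))// lerD.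
apply: (@le_trans _ _ ((1 + (T0 + B0) / amin) * amin)).
  by rewrite mulrDl divfK ?gt_eqF// mul1r lerDr ltW.
by rewrite ler_wpM2l// addr_ge0// divr_ge0 ?addr_ge0// ltW.
Qed.

Lemma ae_K_ge0 : \forall x \ae mu, punctured_eball R0 x -> 0 <= K x.
Proof.
have /ess_infP : (ess_inf_on mu (eball R0) (EFin \o K) <=
  ess_inf mu (patch (fun=> +oo) (eball R0) (EFin \o K)))%E by [].
apply: filterS => x; rewrite /patch => h [xR x0].
move: h; rewrite mem_set//= => h; have := lt_le_trans hK_inf h.
by rewrite lte_fin => /ltW.
Qed.

Lemma ae_Theta_ge0 : \forall y \ae mu, 0 < enorm y <= R1 -> 0 <= Theta g a K y.
Proof.
have [amin [C [amin0 C0 h]]] := ae_coef_bounds.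
have ui : invmx g \in unitmx by rewrite unitmx_inv.
have h' := ae_mulmx ui ae_K_ge0.
apply: filterS2 h h' => y h1 h2 yR.
have [ha _] := h1 yR; rewrite /Theta divr_ge0//.
  by apply: h2; exact: preimage_in_ball.
by apply: le_trans ha; exact: ltW.
Qed.

(** The preimage of the closed shell is compact in the punctured ball, where K is
locally bounded. *)
Lemma ae_Theta_bounded al : 0 < al -> exists2 M : R, 0 < M &
  \forall y \ae mu, al <= enorm y <= R1 -> Theta g a K y <= M.
Proof.
move=> al0; have [amin [C [amin0 C0 h]]] := ae_coef_bounds.
have ui : invmx g \in unitmx by rewrite unitmx_inv.
pose S := [set x : vec | al <= enorm (g *m x) <= R1].
have [c2 c20 c2P] := enorm_mulmx_ge hg.
have SR : S `<=` punctured_eball R0.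
  move=> x /= /andP[h1 h2]; rewrite -[x]mul1mx -(mulVmx hg) -mulmxA.
  by apply: preimage_in_ball; rewrite h2 (lt_le_trans al0).
have clS : closed S.
  have -> : S = (fun x : vec => enorm (g *m x)) @^-1` `[al, R1]%classic.
    by apply/seteqP; split => x /=; rewrite in_itv.
  apply: closed_comp; last exact: interval_closed.
  by move=> x _; exact: continuous_enorm_mulmx.
have cS : compact S.
  apply: (@closed_bounded_compact _ _ _ (R1 / c2)) => // x /= /andP[_ h2].
  by apply: enorm_cube; rewrite ler_pdivlMr// mulrC (le_trans (c2P x)).
have [_ fK] := hK cS SR.
have muT := @lebesgue_setT_gt0 R N.
move: fK; rewrite /finite_norm unlock muT => fK.
have [M MP] : exists M : R, \forall x \ae mu, S x -> K x <= M.
  have [M MP] := @ess_supr_bounded _ _ _ mu (fun x => `|(K \_ S) x|) fK.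
  exists M; apply: filterS MP => x; rewrite /patch => + Sx; rewrite mem_set//.
  by apply: le_trans; exact: ler_norm.
exists (1 + `|M| / amin); first by rewrite ltr_pwDl// divr_ge0// ltW.
have h' := ae_mulmx ui ae_K_ge0; have h'' := ae_mulmx ui MP.
apply: filterS3 h h' h'' => y h1 h2 h3 /andP[y1 y2].
have yR : 0 < enorm y <= R1 by rewrite y2 (lt_le_trans al0).
have [ha _] := h1 yR.
have Ay : 0 < radial_coef g a y by exact: lt_le_trans ha.
have KM : K (pre y) <= M.
  by apply: h3; rewrite /S /= mulmxA mulmxV// mul1mx y1.
have K0 : 0 <= K (pre y) by apply: h2; exact: preimage_in_ball.
rewrite /Theta -/(pre y) ler_pdivrMr//.
apply: (le_trans KM); apply: (le_trans (ler_norm _)).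
apply: (@le_trans _ _ (`|M| / amin * radial_coef g a y)).
  by rewrite mulrAC ler_pdivlMr// ler_wpM2l.
by rewrite ler_wpM2r ?(ltW Ay)// lerDr.
Qed.

Local Notation E := (env (Psi g a b)).
Local Notation T := (env (Theta g a K)).

Lemma env_Psi_bounds : exists2 C : R, 0 < C & forall r : R, 0 < r < R1 ->
  ((- C)%:E <= E r <= C%:E)%E.
Proof.
have [amin [C [amin0 C0 h]]] := ae_coef_bounds; exists C => // r /[dup] rr /andP[r0 _].
apply/andP; split.
- apply: (@env_lb _ _ hN _ 0 R1) => //; apply: filterS h => y h /andP[y0 yR].
  have yR' : 0 < enorm y <= R1 by rewrite y0 ltW.
  by have [_] := h yR'; rewrite ler_norml => /andP[].
- apply: (@env_ub _ _ _ 0 R1) => //; apply: filterS h => y h /andP[y0 yR].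
  have yR' : 0 < enorm y <= R1 by rewrite y0 ltW.
  by have [_] := h yR'; rewrite ler_norml => /andP[].
Qed.

Lemma env_Theta_ge0 r : 0 < r < R1 -> (0 <= T r)%E.
Proof.
move=> /[dup] rr /andP[r0 _]; apply: (@env_lb _ _ hN _ 0 R1 0) => //.
by apply: filterS ae_Theta_ge0 => y h /andP[y0 yR]; apply: h; rewrite y0 ltW.
Qed.

Lemma env_Theta_bounded al : 0 < al -> exists2 M : R, 0 < M &
  forall r : R, al < r < R1 -> (T r <= M%:E)%E.
Proof.
move=> al0; have [M M0 h] := ae_Theta_bounded al0; exists M => // r rr.
apply: (@env_ub _ _ _ al R1) => //.
by apply: filterS h => y h /andP[y0 yR]; apply: h; rewrite !ltW.
Qed.

End ae_bounds.

(** * The lower bound on the envelope and the growth factor *)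

Section lower_bound_everywhere.
Variables (R : realType).
Local Notation leb := (@lebesgue_measure R).

(** If E r < L at one point, then E < L on an interval, which is not null. *)
Lemma usc_ae_lower_bound (E : R -> \bar R) (rho : R) (L : \bar R) :
  (forall (r : R) y, (E r < y)%E -> \forall s \near r, (E s < y)%E) ->
  (\forall r \ae leb, 0 < r < rho -> (L <= E r)%E) ->
  forall r : R, 0 < r < rho -> (L <= E r)%E.
Proof.
move=> usc [Z [mZ Z0 hZ]] r rr; rewrite leNgt; apply/negP => /usc h.
have h2 : \forall s \near r, s \in `]0, rho[ by apply: near_in_itvoo; rewrite in_itv.
have : nbhs r ([set s | (E s < L)%E] `&` [set s | s \in `]0, rho[]).
  by apply: filterI; [exact: h|exact: h2].
move=> /nbhs_ballP[d /= d0 dP].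
have : (leb (ball r d) <= leb Z)%E.
  apply: le_measure; rewrite ?inE//; first exact: measurable_ball.
  move=> s sr; apply: hZ => /= Hs; have [/= s1 s2] := dP s sr.
  by move: s1; rewrite ltNge Hs// -in_itv.
by rewrite Z0 lebesgue_measure_ball ?(ltW d0)// lee_fin mulr2n; lra.
Qed.

Lemma lim_ess_inf_gt (E : R -> \bar R) (y : R) :
  (forall (r : R) y, (E r < y)%E -> \forall s \near r, (E s < y)%E) ->
  (y%:E < lim (ess_inf_on leb `]0%R, rho[ E @[rho --> 0%R^'+]))%E ->
  exists rho eps : R, [/\ 0 < rho, 0 < eps &
    forall r : R, 0 < r < rho -> ((y + eps)%:E <= E r)%E].
Proof.
move=> usc; pose L (rho : R) := ess_inf_on leb `]0%R, rho[ E.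
have Lni : L @ 0^'+ --> ereal_sup (L @` `]0, +oo[%classic).
  apply: (@nonincreasing_at_right_cvge R L 0 +oo%O); first by rewrite bnd_simp.
  move=> r1 r2 _ _ r12; apply: le_ess_inf; apply: aeW => x; rewrite /patch.
  case: ifPn => [x2|x2]; first case: ifPn => // x1.
    by rewrite leey.
  rewrite memNset ?leey// => x1; move: x2; rewrite notin_setE; apply.
  by move: x1; rewrite /= !in_itv/= => /andP[-> /lt_le_trans]; apply.
rewrite (cvg_lim _ Lni)// => /ereal_sup_gt[_ [rho /= + <-]].
rewrite in_itv/= andbT => rho0 yL.
have LE (l : \bar R) : (l <= L rho)%E -> forall r : R, 0 < r < rho -> (l <= E r)%E.
  move=> /ess_infP h; apply: usc_ae_lower_bound => //.
  by apply: filterS h => x; rewrite /patch => + xr; rewrite mem_set//= in_itv.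
case EL : (L rho) yL => [l| |]//.
- rewrite lte_fin => yl; exists rho, (l - y); split; rewrite ?subr_gt0//.
  by apply: LE; rewrite EL lee_fin; lra.
- by move=> _; exists rho, 1; split => //; apply: LE; rewrite EL leey.
Qed.

End lower_bound_everywhere.

Section growth_bound.
Variables (R : realType).
Local Notation leb := (@lebesgue_measure R).
Variables (rho0 rho R1 C : R) (e F FE : R -> R).
Hypothesis rho_gt0 : 0 < rho.
Hypothesis rho_lt : rho < rho0.
Hypothesis rho0_lt : rho0 < R1.
Hypothesis me : measurable_fun `]0, R1[%classic e.
Hypothesis eC : forall r : R, 0 < r < R1 -> - C <= e r <= C.
Hypothesis cF : forall r : R, 0 < r < rho0 -> {for r, continuous F}.
Hypothesis eF : forall r : R, 0 < r < rho0 -> e r <= F r.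
Hypothesis dFE : forall r : R, 0 < r < rho0 -> is_derive r 1 FE (F r / r).
Hypothesis mFe : measurable_fun `]0, rho0[%classic (fun r => r^-1 * (F r - e r)).
Hypothesis iFe : (\int[leb]_(r in `]0%R, rho0[) (r^-1 * (F r - e r))%:E <= 1)%E.

Lemma inv_measurable_pos (D : set R) : measurable D -> D `<=` `]0, R1[%classic ->
  measurable_fun D (fun r : R => r^-1).
Proof.
move=> mD DR; apply: (measurable_funS (E := `]0, R1[%classic)) => //.
apply: open_continuous_measurable_fun; first exact: interval_open.
move=> x; rewrite inE/= in_itv/= => /andP[x0 _].
by apply: inv_continuous; rewrite gt_eqF.
Qed.

(** Up to an additive constant, FE rho - FE r bounds the exponent of the growth
factor from below: on ]r, rho] replacing e by F costs at most 1, and on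
]rho, R1[ the integrand is bounded. Hence exp (- FE) is at most a constant
multiple of the growth factor. *)
Lemma integral_growth_lb : exists D : R, forall r : R, 0 < r < rho ->
  (((FE rho - FE r) - D)%:E <= \int[leb]_(t in `]r, R1[) (e t / t)%:E)%E.
Proof.
have C0 : 0 <= C.
  have : 0 < rho0 < R1 by rewrite rho0_lt andbT (lt_trans rho_gt0).
  by move=> /eC /andP[h1 h2]; lra.
exists (1 + C / rho * (R1 - rho)) => r /andP[r0 rr].
have rR : rho < R1 by exact: lt_trans rho0_lt.
have ie : leb.-integrable `]r, R1[ (EFin \o (fun t => e t / t)).
  apply: measurable_bounded_integrable => //.
  - have h : leb `]r, R1[%classic = (R1 - r)%:E.
      by rewrite lebesgue_measure_itv/= lte_fin (lt_trans rr rR) -EFinB.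
    by rewrite [X in (X < _)%E]h; exact: ltry.
  - apply: measurable_funM.
      apply: (measurable_funS (E := `]0, R1[%classic)) => //.
      by apply: subset_itvr; rewrite bnd_simp ltW.
    apply: inv_measurable_pos => //.
    by apply: subset_itvr; rewrite bnd_simp ltW.
  - exists (C / r); split; first exact: num_real.
    move=> M /ltW CM t; rewrite /= in_itv/= => /andP[rt tR].
    have t0 : 0 < t by exact: lt_trans rt.
    apply: le_trans CM; rewrite normrM normfV (gtr0_norm t0).
    apply: ler_pM => //; first by rewrite invr_ge0 ltW.
      by rewrite ler_norml; apply: eC; rewrite t0.
    by rewrite lef_pV2 ?posrE// ltW.
rewrite -[leRHS]fineK; last exact: integrable_fin_num.
rewrite lee_fin -/(Rintegral leb `]r, R1[ (fun t => e t / t)).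
have /= := @Rintegral_itvB R _ (BRight r) (BLeft R1) rho ie.
rewrite !bnd_simp => /(_ (ltW rr) rR).
have ie1 : leb.-integrable `]r, rho] (EFin \o (fun t => e t / t)).
  by apply: integrableS ie => //; apply: subset_itvl; rewrite bnd_simp.
have ie2 : leb.-integrable `]rho, R1[ (EFin \o (fun t => e t / t)).
  by apply: integrableS ie => //; apply: subset_itvr; rewrite bnd_simp ltW.
have muE : leb `]rho, R1[%classic = (R1 - rho)%:E.
  by rewrite lebesgue_measure_itv/= lte_fin rR -EFinB.
have h2 : - (C / rho * (R1 - rho)) <= \int[leb]_(t in `]rho, R1[) (e t / t).
  have -> : - (C / rho * (R1 - rho)) = \int[leb]_(t in `]rho, R1[) (- (C / rho)).
    rewrite Rintegral_cst//; transitivity (- (C / rho) * fine (R1 - rho)%:E).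
      by rewrite /=; ring.
    by congr (_ * fine _); exact/esym.
  apply: le_Rintegral => //.
    apply/integrableP; split; first exact: measurable_cst.
    rewrite (_ : (fun x => _) = cst (`|(- (C / rho))%:E|)%E)//.
    by rewrite integral_cst// [X in (_ * X)%E]muE -EFinM; exact: ltry.
  move=> t; rewrite /= in_itv/= => /andP[rt tR].
  have t0 : 0 < t by exact: lt_trans rt.
  have /andP[e1 _] : - C <= e t <= C by apply: eC; rewrite t0.
  apply: (@le_trans _ _ (- C / t)); last by rewrite ler_pM2r ?invr_gt0.
  by rewrite mulNr lerN2 ler_wpM2l// lef_pV2 ?posrE// ltW.
have cFt x : 0 < x < rho0 -> {for x, continuous (fun t => F t / t)}.
  move=> /[dup] xx /andP[x0 _]; apply: continuousM; first exact: cF.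
  by apply: inv_continuous; rewrite gt_eqF.
have iF : leb.-integrable `]r, rho] (EFin \o (fun t => F t / t)).
  have iFc : leb.-integrable `[r, rho] (EFin \o (fun t => F t / t)).
    apply: continuous_compact_integrable; first exact: segment_compact.
    apply: continuous_in_subspaceT => x; rewrite inE/= in_itv/= => /andP[rx xr].
    by apply: cFt; rewrite (lt_le_trans r0)//= (le_lt_trans xr).
  by apply: integrableS iFc => //; apply: subset_itvr; rewrite bnd_simp.
have h1 : FE rho - FE r - 1 <= \int[leb]_(t in `]r, rho]) (e t / t).
  have FEE : \int[leb]_(t in `]r, rho]) (F t / t) = FE rho - FE r.
    rewrite Rintegral_itv_obnd_cbnd; last by have /integrableP[/measurable_EFinP] := iF.
    by rewrite /Rintegral (integral_derive cFt dFE r0 rr rho_lt).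
  have := RintegralB _ iF ie1; rewrite FEE => /(_ (measurable_itv _)).
  suff : \int[leb]_(t in `]r, rho]) (F t / t - e t / t) <= 1 by lra.
  have sub : (`]r, rho]%classic : set R) `<=` `]0, rho0[%classic.
    move=> t; rewrite /= !in_itv/= => /andP[rt tr].
    by rewrite (lt_trans r0)//= (le_lt_trans tr).
  have : (\int[leb]_(t in `]r, rho]) (F t / t - e t / t)%:E <= 1)%E.
    have -> : (\int[leb]_(t in `]r, rho]) (F t / t - e t / t)%:E =
        \int[leb]_(t in `]r, rho]) (t^-1 * (F t - e t))%:E)%E.
      by apply: eq_integral => t _; congr EFin; rewrite mulrBr !(mulrC t^-1).
    apply: (le_trans _ iFe).
    apply: ge0_subset_integral => //; first exact/measurable_EFinP.
    move=> t; rewrite /= in_itv/= => /[dup] tt /andP[t0 _].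
    by rewrite lee_fin mulr_ge0 ?invr_ge0 ?(ltW t0)// subr_ge0 eF.
  rewrite -[X in (X <= _)%E]fineK ?lee_fin//.
  under eq_integral do rewrite EFinB.
  by apply: integrable_fin_num => //; exact: integrableB.
move=> /(canRL (subrK _)) ->; apply: le_trans (lerD h2 h1).
by rewrite le_eqVlt; apply/orP; left; apply/eqP; ring.
Qed.

End growth_bound.

(** * The radial profile *)

Section radial_profile.
Variables (R : realType).
Local Notation leb := (@lebesgue_measure R).
Variables (R1 C p eps : R) (rho1 : R) (E T : R -> \bar R).
Hypothesis R10 : 0 < R1.
Hypothesis p1 : 1 < p.
Hypothesis usc_E : forall (r : R) z, (E r < z)%E -> \forall s \near r, (E s < z)%E.
Hypothesis usc_T : forall (r : R) z, (T r < z)%E -> \forall s \near r, (T s < z)%E.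
Hypothesis C0 : 0 < C.
Hypothesis E_bound : forall r : R, 0 < r < R1 -> ((- C)%:E <= E r <= C%:E)%E.
Hypothesis T_ge0 : forall r : R, 0 < r < R1 -> (0 <= T r)%E.
Hypothesis T_bound : forall al : R, 0 < al -> exists2 M : R, 0 < M &
  forall r : R, al < r < R1 -> (T r <= M%:E)%E.
Hypothesis rho10 : 0 < rho1.
Hypothesis eps0 : 0 < eps.
Hypothesis E_gt2 : forall r : R, 0 < r < rho1 -> ((2 + eps)%:E <= E r)%E.
Let gr r := expeR (\int[leb]_(t in `]r, R1[) (E t * (t^-1)%:E))%E.
Hypothesis hint : (\int[leb]_(r in `]0%R, R1[)
  (poweR (gr r) (p - 1) * T r * (r `^ (2 * p - 1))%:E) < +oo)%E.

Let e r := fine (E r).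
Let t r := fine (T r).

Let EE r : 0 < r < R1 -> E r = (e r)%:E.
Proof.
move=> /E_bound /andP[h1 h2]; rewrite /e fineK// fin_numElt.
by rewrite (lt_le_trans _ h1) ?ltNyr// (le_lt_trans h2) ?ltry.
Qed.

Let TE r : 0 < r < R1 -> T r = (t r)%:E.
Proof.
move=> /[dup] rr /andP[r0 rR]; rewrite /t fineK// fin_numElt.
rewrite (lt_le_trans _ (T_ge0 rr)) ?ltNyr//=.
have r20 : 0 < r / 2 by rewrite divr_gt0.
have [M M0 TM] := T_bound r20.
by rewrite (le_lt_trans (TM r _)) ?ltry// rR andbT ltr_pdivrMr// ltr_pMr// ltr1n.
Qed.

Let usc_fine (X : R -> \bar R) :
  (forall (r : R) z, (X r < z)%E -> \forall s \near r, (X s < z)%E) ->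
  (forall r : R, 0 < r < R1 -> X r = (fine (X r))%:E) ->
  forall r z : R, 0 < r < R1 -> fine (X r) < z -> \forall s \near r, fine (X s) < z.
Proof.
move=> usc XE r z rr Xz.
have h : \forall s \near r, (X s < z%:E)%E by apply: usc; rewrite XE// lte_fin.
have h2 : \forall s \near r, s \in `]0, R1[ by apply: near_in_itvoo; rewrite in_itv.
apply: filterS2 h h2 => s; rewrite in_itv/= => h sr.
by rewrite -lte_fin -XE.
Qed.

Let me : measurable_fun `]0, R1[%classic e.
Proof. by apply: usc_measurable => r z; exact: usc_fine. Qed.

Let eC r : 0 < r < R1 -> - C <= e r <= C.
Proof. by move=> rr; have := E_bound rr; rewrite EE// !lee_fin. Qed.

(** Passage from the integral condition on the envelopes to the continuous data of
radial_subsolution. The majorant F of E comes first, because it determines the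
weight w = M^(p-1) r^(2p-1) under which T has to be approximated; this weight is
at most a multiple of the one in the integral condition, so w T is integrable,
and so is w t' for a majorant t' with w (t' - T) integrable. *)
Lemma radial_profile : exists rho' (U G dG : R -> R),
  [/\ 0 < rho' < R1,
      forall r : R, 0 < r < rho' -> [/\ is_derive r 1 U (- r * G r), is_derive r 1 G (dG r),
        {for r, continuous dG}, 0 < U r & 0 < G r],
      forall r : R, 0 < r < rho' -> t r * U r `^ p <= - (r * dG r) - G r * e r &
      forall A : R, exists2 d : R, 0 < d & forall r : R, 0 < r < d -> A <= U r].
Proof.
pose rho0 := Num.min rho1 R1 / 2.
have m0 : 0 < Num.min rho1 R1 by rewrite lt_min rho10.
have rho00 : 0 < rho0 by rewrite divr_gt0.
have rho0m : rho0 < Num.min rho1 R1 by rewrite /rho0 ltr_pdivrMr// ltr_pMr// ltr1n.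
have /andP[rho0_1 rho0_R] : (rho0 < rho1) && (rho0 < R1) by rewrite -lt_min.
have in0 r : 0 < r < rho0 -> 0 < r < R1 by move=> /andP[-> h]; exact: lt_trans h _.
have e2 r : 0 < r < rho0 -> 2 + eps <= e r.
  move=> rr; rewrite -lee_fin; have <- := EE (in0 _ rr); apply: E_gt2.
  by case/andP: rr => -> h; exact: lt_trans h _.
have cV (r : R) : 0 < r -> {for r, continuous (fun x : R => x^-1)}.
  by move=> r0; apply: inv_continuous; rewrite gt_eqF.
(* The error is measured with the weight 1 / r because FE, the exponent of 1 / M,
   is the antiderivative of F / r. *)
have [F [cF eF mFe iFe]] : exists F : R -> R,
  [/\ forall r : R, 0 < r < rho0 -> {for r, continuous F},
      forall r : R, 0 < r < rho0 -> e r <= F r,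
      measurable_fun `]0, rho0[%classic (fun r => r^-1 * (F r - e r)) &
      (\int[leb]_(r in `]0%R, rho0[) (r^-1 * (F r - e r))%:E <= 1)%E].
  apply: usc_approximation => //.
  - by move=> r rr; apply: (le_trans _ (e2 r rr)); rewrite addr_ge0// ltW.
  - move=> al al0; exists C => // r /andP[r1 r2].
    have rr : 0 < r < rho0 by rewrite r2 (lt_trans al0 r1).
    by have /andP[] := eC (in0 _ rr).
  - by move=> r z rr; apply: usc_fine => //; exact: in0.
  - by move=> r /andP[r0 _]; rewrite invr_ge0 ltW.
  - move=> al al0; exists al^-1; rewrite ?invr_gt0// => r /andP[r1 r2].
    by rewrite lef_pV2 ?posrE ?(lt_trans al0 r1)// ltW.
  - by move=> r /andP[r0 _]; exact: cV.
have [FE dFE] : exists FE : R -> R, forall r : R, 0 < r < rho0 -> is_derive r 1 FE (F r / r).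
  apply: antiderivative => // r /[dup] rr /andP[r0 _].
  by apply: continuousM; [exact: cF|exact: cV].
(* FE is controlled only inside ]0, rho0[; on the smaller interval the weight w
   below is bounded near the right end, and FE rho serves as the reference value. *)
pose rho := rho0 / 2.
have rho_gt0 : 0 < rho by rewrite divr_gt0.
have rho_lt : rho < rho0 by rewrite /rho ltr_pdivrMr// ltr_pMr// ltr1n.
have in1 r : 0 < r < rho -> 0 < r < rho0 by move=> /andP[-> h]; exact: lt_trans h _.
have [D HD] := integral_growth_lb rho_gt0 rho_lt rho0_R me eC cF eF dFE mFe iFe.
pose M r := expR (- FE r).
have M0 r : 0 < M r by exact: expR_gt0.
pose c0 := expR (FE rho - D).
have c00 : 0 < c0 by exact: expR_gt0.
have grM r : 0 < r < rho -> ((c0 * M r)%:E <= gr r)%E.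
  move=> rr; have -> : (c0 * M r)%:E = expeR ((FE rho - FE r) - D)%:E.
    by rewrite /= /c0 /M -expRD; congr (expR _)%:E; ring.
  rewrite /gr; rewrite lee_expeR.
  rewrite (_ : (\int[leb]_(t in `]r, R1[) (E t * t^-1%:E))%E =
    (\int[leb]_(t in `]r, R1[) (e t / t)%:E)%E); first exact: HD.
  apply: eq_integral => x; rewrite inE/= in_itv/= => /andP[rx xR].
  by rewrite EE// xR andbT (lt_trans _ rx)//; case/andP: rr.
pose w r := M r `^ (p - 1) * r `^ (2 * p - 1).
have p10 : 0 <= p - 1 by rewrite subr_ge0 ltW.
have p20 : 0 <= 2 * p - 1.
  by rewrite mulrDl mul1r -addrA addr_ge0// (le_trans _ (ltW p1)).
have w0 r : 0 <= w r by rewrite mulr_ge0 ?powR_ge0.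
have cM r : 0 < r < rho0 -> {for r, continuous M}.
  move=> rr; apply: (@continuous_comp _ _ _ (fun s => - FE s) expR); last exact: continuous_expR.
  by apply: continuousN; exact: is_derive_continuous (dFE _ rr).
have cw r : 0 < r < rho0 -> {for r, continuous w}.
  move=> /[dup] rr /andP[r0 _]; apply: continuousM; last exact: continuous_powR_gt0.
  apply: (@continuous_comp _ _ _ M (fun s => s `^ (p - 1))); first exact: cM.
  exact: continuous_powR_gt0.
have Mni x z : 0 < x -> x <= z -> z < rho0 -> M z <= M x.
  move=> x0 xz zr; rewrite ler_expR.
  apply: (@derive_le0_nincr R rho0 (- FE) (fun r => - (F r / r))) => // r rr.
    by apply: is_deriveN; exact: dFE.
  have := e2 _ rr; have := eF _ rr; have /andP[r0 _] := rr => h1 h2.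
  rewrite oppr_le0 divr_ge0 ?(ltW r0)//; apply: le_trans h1; apply: le_trans h2.
  by rewrite addr_ge0// ltW.
have t0 r : 0 < r < rho -> 0 <= t r.
  move=> rr; have := T_ge0 (in0 _ (in1 _ rr)).
  by rewrite TE ?lee_fin//; apply/in0/in1.
have [t' [ct' tt' mt' it']] : exists t' : R -> R,
  [/\ forall r : R, 0 < r < rho -> {for r, continuous t'},
      forall r : R, 0 < r < rho -> t r <= t' r,
      measurable_fun `]0, rho[%classic (fun r => w r * (t' r - t r)) &
      (\int[leb]_(r in `]0%R, rho[) (w r * (t' r - t r))%:E <= 1)%E].
  apply: usc_approximation => //.
  - move=> al al0; have [B B0 TB] := T_bound al0; exists B => // r /andP[r1 r2].
    have rr : 0 < r < R1 by apply/in0/in1; rewrite r2 (lt_trans al0).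
    by rewrite -lee_fin -TE//; apply: TB; rewrite r1; case/andP: rr.
  - by move=> r z rr; apply: usc_fine => //; apply/in0/in1.
  - move=> al al0; exists (1 + M al `^ (p - 1) * rho `^ (2 * p - 1)).
      by rewrite ltr_pwDl// mulr_ge0 ?powR_ge0.
    move=> r /andP[r1 r2]; have r0 : 0 < r by exact: lt_trans r1.
    apply: ler_wpDl; first exact: ler01.
    apply: ler_pM; [exact: powR_ge0|exact: powR_ge0| |].
      apply: ge0_ler_powR; rewrite ?nnegrE ?(ltW (M0 _))//.
      by apply: Mni => //; [exact: ltW|exact: lt_trans rho_lt].
    by apply: ge0_ler_powR; rewrite ?nnegrE ?(ltW r0) ?(ltW rho_gt0)// ltW.
  - by move=> r rr; apply: cw; exact: in1.
have mw : measurable_fun `]0, rho[%classic w.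
  apply: open_continuous_measurable_fun; first exact: interval_open.
  by move=> x; rewrite inE/= in_itv/= => xx; apply: cw; exact: in1.
have mt : measurable_fun `]0, rho[%classic t.
  by apply: usc_measurable => r z rr; apply: usc_fine => //; apply/in0/in1.
have wt_fin : (\int[leb]_(r in `]0%R, rho[) (w r * t r)%:E < +oo)%E.
  have k0 : 0 < c0 `^ (p - 1) by rewrite powR_gt0.
  have : (\int[leb]_(r in `]0%R, rho[) ((c0 `^ (p - 1))%:E * (w r * t r)%:E) < +oo)%E.
    apply: (le_lt_trans _ hint); apply: ge0_le_integral_nonmeas.
    - move=> r; rewrite /= !in_itv/= => /andP[-> h].
      by rewrite (lt_trans h)// (lt_trans rho_lt).
    - move=> r; rewrite /= in_itv/= => rr.
      by rewrite lee_fin !mulr_ge0 ?powR_ge0// t0.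
    - move=> r; rewrite /= in_itv/= => rr.
      by rewrite !mule_ge0 ?poweR_ge0 ?T_ge0// lee_fin powR_ge0.
    - move=> r; rewrite /= in_itv/= => rr; rewrite TE; last by apply/in0/in1.
      have -> : ((c0 `^ (p - 1))%:E * (w r * t r)%:E =
          ((c0 * M r) `^ (p - 1))%:E * (t r)%:E * (r `^ (2 * p - 1))%:E)%E.
        rewrite -!EFinM; congr EFin; rewrite powRM ?(ltW c00) ?(ltW (M0 _))// /w.
        by move: (c0 `^ _) (M r `^ _) (r `^ _) (t r) => x1 x2 x3 x4; ring.
      apply: lee_pmul => //.
      + by rewrite lee_fin mulr_ge0 ?powR_ge0// t0.
      + by rewrite lee_fin powR_ge0.
      + apply: lee_pmul => //; rewrite ?lee_fin ?powR_ge0 ?t0//.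
        rewrite -poweR_EFin; apply: gt0_ler_poweR => //.
        * by rewrite in_itv/= leey andbT lee_fin mulr_ge0// ltW.
        * by rewrite in_itv/= leey andbT expeR_ge0.
        * exact: grM.
  rewrite ge0_integralZl_EFin//; last 3 first.
  - by move=> r; rewrite /= in_itv/= => rr; rewrite lee_fin mulr_ge0// t0.
  - by apply/measurable_EFinP; exact: measurable_funM.
  - exact: ltW.
  case: (X in (_ * X)%E) => [x _|//|_]; [by rewrite ltry| |by []].
  by rewrite gt0_muley// lte_fin.
pose h r := t' r * M r `^ (p - 1) * r `^ (2 * p - 1).
have hE r : h r = w r * t r + w r * (t' r - t r) by rewrite /h /w; ring.
have h0 r : 0 < r < rho -> 0 <= h r.
  move=> rr; rewrite /h !mulr_ge0 ?powR_ge0//.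
  by apply: le_trans (tt' _ rr); exact: t0.
have ch r : 0 < r < rho -> {for r, continuous h}.
  move=> rr; rewrite (_ : h = fun r => t' r * w r); last by apply/funext => s; rewrite /h mulrA.
  by apply: continuousM; [exact: ct'|apply: cw; exact: in1].
have h_fin : (\int[leb]_(r in `]0%R, rho[) (h r)%:E < +oo)%E.
  have -> : (\int[leb]_(r in `]0%R, rho[) (h r)%:E =
      \int[leb]_(r in `]0%R, rho[) ((w r * t r)%:E + (w r * (t' r - t r))%:E))%E.
    by apply: eq_integral => r _; rewrite hE EFinD.
  rewrite ge0_integralD//.
  - apply: lte_add_pinfty; first exact: wt_fin.
    by apply: (le_lt_trans it'); exact: ltry.
  - by move=> r; rewrite /= in_itv/= => rr; rewrite lee_fin mulr_ge0// t0.
  - by apply/measurable_EFinP; exact: measurable_funM.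
  - by move=> r; rewrite /= in_itv/= => rr; rewrite lee_fin mulr_ge0// subr_ge0 tt'.
  - exact/measurable_EFinP.
have h_fin_num : (\int[leb]_(r in `]0%R, rho[) (h r)%:E)%E \is a fin_num.
  rewrite ge0_fin_numE//; apply: integral_ge0 => r; rewrite /= in_itv/= => rr.
  by rewrite lee_fin h0.
have [FH dFH] : exists FH : R -> R, forall r : R, 0 < r < rho -> is_derive r 1 FH (h r).
  exact: antiderivative.
have FH_lb : exists L, forall r : R, 0 < r < rho -> L <= FH r.
  apply: (@antiderivative_lb R rho h FH (fine (\int[leb]_(r in `]0%R, rho[) (h r)%:E)%E)) => //.
  by rewrite fineK.
have [rho' [U [G [dG [rr' H1 H2 H3]]]]] :=
  @radial_subsolution R rho eps p F t' FE FH rho_gt0 eps0 p1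
    (fun r rr => cF r (in1 r rr)) ct'
    (fun r rr => le_trans (e2 r (in1 r rr)) (eF r (in1 r rr)))
    (fun r rr => le_trans (t0 r rr) (tt' r rr))
    (fun r rr => dFE r (in1 r rr)) dFH FH_lb.
have /andP[rho'0 rho'r] := rr'.
exists rho', U, G, dG; split => //.
- by rewrite rho'0 (lt_trans rho'r)// (lt_trans rho_lt).
- move=> r rr; have [_ _ _ U0 G0] := H1 r rr.
  have rr2 : 0 < r < rho by case/andP: rr => -> h'; exact: lt_trans h' _.
  apply: (@le_trans _ _ (t' r * U r `^ p)).
    by rewrite ler_wpM2r ?powR_ge0// tt'.
  apply: (le_trans (H2 r rr)).
  by rewrite lerB// ler_wpM2l ?(ltW G0)//; apply: eF; exact: in1.
Qed.

End radial_profile.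

(** * Regularity and singularity of functions of |g x| *)

Section radial_regularity.
Variables (R : realType) (n : nat) (g : 'M[R]_n).
Hypothesis hg : g \in unitmx.
Local Notation vec := 'cV[R]_n.
Let s (x : vec) := enorm (g *m x).

Lemma open_annulus (e r : R) : open (annulus e r : set vec).
Proof.
rewrite (_ : annulus e r = (fun x => enorm x) @^-1` `]e, r[%classic); last first.
  by apply/seteqP; split => x; rewrite /annulus /= in_itv.
by apply: open_comp => [x _|]; [exact: continuous_enorm|exact: interval_open].
Qed.

Lemma punctured_eballE (r : R) : punctured_eball r = annulus 0 r :> set vec.
Proof.
apply/seteqP; split => x; rewrite /punctured_eball /annulus /eball /=.
  by move=> [xr x0]; rewrite xr andbT; exact: enorm_gt0.
move=> /andP[x0 xr]; split => // xE.
by move: x0; rewrite xE enorm0 ltxx.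
Qed.

Variables (U G dG : R -> R) (rho : R).
Hypothesis dU : forall t : R, 0 < t < rho -> is_derive t 1 U (- t * G t).
Hypothesis dGP : forall t : R, 0 < t < rho -> is_derive t 1 G (dG t).
Hypothesis cdG : forall t : R, 0 < t < rho -> {for t, continuous dG}.

(** The annulus lies in a compact set on which |g x| stays away from 0 and from rho.
The derivatives are continuous, hence bounded there. *)
Lemma radial_fun_sobolev (q e r s1 : R) : 0 < q -> 0 < e -> 0 < r -> s1 < rho ->
  (forall x, enorm x < r -> s x <= s1) ->
  sobolev 2 q%:E (annulus e r) (radial_fun g U).
Proof.
move=> q0 e0 r0 s1rho rs; have [cg cg0 cgP] := enorm_mulmx_ge hg.
have ce0 : 0 < cg * e by rewrite mulr_gt0.
pose S : set vec := [set x | cg * e <= s x <= s1] `&` [set x | enorm x <= r].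
have DS : annulus e r `<=` S.
  move=> x /andP[ex xr]; split; last exact: ltW.
  by rewrite /= rs// andbT (le_trans _ (cgP x))// ler_pM2l// ltW.
have Srho x : S x -> 0 < s x < rho.
  by move=> [/andP[h1 h2] _]; rewrite (lt_le_trans ce0 h1) (le_lt_trans h2).
have cS : compact S.
  apply: (@closed_bounded_compact _ _ _ r); last by move=> x [_ /enorm_cube].
  apply: closedI.
    rewrite (_ : mkset _ = s @^-1` `[cg * e, s1]%classic); last first.
      by apply/seteqP; split => x; rewrite /= in_itv.
    apply: closed_comp => [x _|]; first exact: continuous_enorm_mulmx.
    exact: interval_closed.
  rewrite (_ : mkset _ = (fun x => enorm x) @^-1` `]-oo, r]%classic); last first.
    by apply/seteqP; split => x; rewrite /= in_itv.
  apply: closed_comp => [x _|]; first exact: continuous_enorm.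
  exact: interval_closed.
have cu x : 0 < s x < rho -> {for x, continuous (radial_fun g U)}.
  by move=> h; exact: (radial_fun_continuous dU).
have cdu i x : 0 < s x < rho -> {for x, continuous (radial_fun1 g G i)}.
  by move=> h; exact: (radial_fun1_continuous dGP).
have cd2u i j x : 0 < s x < rho -> {for x, continuous (radial_fun2 g G dG i j)}.
  by move=> h; exact: (radial_fun2_continuous dGP cdG).
have [M0 M00 uM] := compact_fun_bounded cS (fun x Sx => cu x (Srho x Sx)).
have /choice[M1 duM] i : exists M1, 0 < M1 /\ forall x, S x -> `|radial_fun1 g G i x| <= M1.
  by have [M1 ? ?] := compact_fun_bounded cS (fun x Sx => cdu i x (Srho x Sx)); exists M1.
have /choice[M2 d2uM] (ij : 'I_n * 'I_n) : exists M2, 0 < M2 /\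
    forall x, S x -> `|radial_fun2 g G dG ij.1 ij.2 x| <= M2.
  by have [M2 ? ?] := compact_fun_bounded cS (fun x Sx => cd2u ij.1 ij.2 x (Srho x Sx)); exists M2.
have S1 : 0 <= \sum_i M1 i by apply: sumr_ge0 => i _; apply: ltW; exact: (duM i).1.
have S2 : 0 <= \sum_ij M2 ij by apply: sumr_ge0 => i _; apply: ltW; exact: (d2uM i).1.
apply: (@sobolev_smooth _ _ _ _ (radial_fun1 g G) (radial_fun2 g G dG) _ _ _ _ _ _ _ r
    (M0 + \sum_i M1 i + \sum_ij M2 ij)) => //.
- exact: open_annulus.
- by move=> x /DS/Srho; exact: cu.
- by move=> i x /DS/Srho; exact: cdu.
- by move=> i j x /DS/Srho; exact: cd2u.
- by move=> i x /DS/Srho; exact: (radial_fun_derive dU).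
- by move=> i j x /DS/Srho; exact: (radial_fun1_derive dGP).
- exact: ltW.
- by move=> x /DS[_ /enorm_cube].
- by move=> x /DS/uM h; apply: (le_trans h); rewrite -addrA lerDl addr_ge0.
- move=> i x /DS/(duM i).2 h; apply: (le_trans h).
  rewrite -addrA addrCA (bigD1 i)//= -addrA lerDl !addr_ge0// ?(ltW M00)//.
  by apply: sumr_ge0 => k _; apply: ltW; exact: (duM k).1.
- move=> i j x /DS/(d2uM (i, j)).2 h; apply: (le_trans h).
  rewrite addrC (bigD1 (i, j))//= -addrA lerDl !addr_ge0// ?(ltW M00)//.
  by apply: sumr_ge0 => k _; apply: ltW; exact: (d2uM k).1.
Qed.

(** Every neighborhood of 0 contains points of a coordinate axis at which |g x| is
positive and as small as desired. *)
Lemma radial_fun_singular : (0 < n)%N ->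
  (forall A : R, exists2 d : R, 0 < d & forall t : R, 0 < t < d -> A <= U t) ->
  singular (radial_fun g U).
Proof.
move=> n0 Uoo; rewrite /singular /limf_esup; apply/ereal_inf_pinfty => _ [V V0 <-].
have [cg cg0 cgP] := enorm_mulmx_ge hg.
apply/eqP; rewrite eq_le leey/= leye_eq; apply/eqP/eqyP => A A0.
have [d d0 Ud] := Uoo A; pose v : vec := delta_mx (Ordinal n0) 0.
have W0 : nbhs (0 : vec) [set x | x != 0 -> V x /\ s x < d].
  have V0' : nbhs (0 : vec) [set x | x != 0 -> V x] by exact: V0.
  have s0 : nbhs (0 : vec) [set x | s x < d].
    have : nbhs (s 0) [set t | t < d].
      by apply: open_nbhs_nbhs; split; [exact: open_lt|rewrite /= /s mulmx0 enorm0].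
    exact: continuous_enorm_mulmx.
  by apply: filterS2 V0' s0 => x h1 h2 /h1.
have vW : \forall t \near (0 : R)^'+, t *: v != 0 -> V (t *: v) /\ s (t *: v) < d.
  have cv : (fun t : R => t *: v) @ (0 : R) --> (0 : vec).
    by rewrite -[X in _ --> X](scale0r v); exact: scalel_continuous.
  have h : nbhs (0 : R) [set t | t *: v != 0 -> V (t *: v) /\ s (t *: v) < d] by exact: (cv _ W0).
  rewrite near_withinE; apply: filterS h => t h _; exact: h.
have vt : \forall t \near (0 : R)^'+, 0 < t by exact: nbhs_right_gt.
have [t [tW t0]] := filter_ex (filterI vW vt).
have tv0 : t *: v != 0.
  apply/eqP => /matrixP /(_ (Ordinal n0) 0); rewrite !mxE !eqxx mulr1 => tE.
  by move: t0; rewrite tE ltxx.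
have [Vtv stv] := tW tv0.
apply: (@le_trans _ _ (radial_fun g U (t *: v))%:E).
  rewrite lee_fin; apply: Ud; rewrite stv andbT.
  by apply: (lt_le_trans _ (cgP _)); rewrite mulr_gt0// enorm_gt0//; exact/eqP.
by apply: ereal_sup_ubound; exists (t *: v).
Qed.

End radial_regularity.

Theorem corollary1p13 (R : realType) (N : nat) (hN : (0 < N)%N)
    (R0 : R) (hR0 : 0 < R0)
    (a : 'cV[R]_N -> 'M[R]_N) (b : 'cV[R]_N -> 'cV[R]_N) (K : 'cV[R]_N -> R)
    (ha : forall i j, in_Lp +oo%E (eball R0) (fun x => a x i j))
    (ha_sym : \forall x \ae lebesgue R N, eball R0 x -> (a x)^T = a x)
    (nu : R) (hnu : 1 < nu)
    (ha_ell : \forall x \ae lebesgue R N, punctured_eball R0 x ->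
      forall xi : 'cV[R]_N,
        nu^-1 * enorm xi ^+ 2 <= \sum_i \sum_j a x i j * xi i 0 * xi j 0
          <= nu * enorm xi ^+ 2)
    (hb : forall i, in_Lp_loc +oo%E (punctured_eball R0) (fun x => b x i 0))
    (c : R) (hc : 0 < c)
    (hb_bound : forall i, \forall x \ae lebesgue R N, punctured_eball R0 x ->
      `|b x i 0| <= c / enorm x)
    (hK : in_Lp_loc +oo%E (punctured_eball R0) K)
    (hK_inf : (0 < ess_inf_on (lebesgue R N) (eball R0) (EFin \o K))%E)
    (p : R) (hp : 1 < p)
    (g : 'M[R]_N) (hg : g \in unitmx)
    (R1 : R) (hR1 : 0 < R1)
    (hR1_sub : [set x : 'cV[R]_N | enorm x <= R1] `<=`
      (fun x => g *m x) @` eball R0)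
    (hPsi : (2%:E < lim (ess_inf_on (@lebesgue_measure R) `]0%R, rho[
      (env (Psi g a b)) @[rho --> 0%R^'+]))%E)
    (hint : (\int[lebesgue_measure]_(r in `]0%R, R1[)
      (poweR (growth g a b R1 r) (p - 1) * env (Theta g a K) r
        * (r `^ (2 * p - 1))%:E) < +oo)%E) :
  exists u : 'cV[R]_N -> R, solution R0 a b K p u /\ singular u.
Proof.
have [CP CP0 PsiC] := env_Psi_bounds hN hnu ha_ell hc hb_bound hg hR1_sub.
have T_ge0 := env_Theta_ge0 hN hnu ha_ell hc hb_bound hK_inf hg hR1_sub.
have T_bd := env_Theta_bounded hnu ha_ell hc hb_bound hK hK_inf hg hR1_sub.
have uscE (r : R) z : (env (Psi g a b) r < z)%E -> \forall s \near r, (env (Psi g a b) s < z)%E.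
  exact: env_near.
have uscT (r : R) z : (env (Theta g a K) r < z)%E -> \forall s \near r, (env (Theta g a K) s < z)%E.
  exact: env_near.
have [rho1 [eps [rho10 eps0 E_gt2]]] := lim_ess_inf_gt uscE hPsi.
have [rho [U [G [dG [/andP[rho0 rhoR1] profile UP Uoo]]]]] :=
  radial_profile hR1 hp uscE uscT CP0 PsiC T_ge0 T_bd rho10 eps0 E_gt2 hint.
pose s (x : 'cV[R]_N) := enorm (g *m x).
have dU (t : R) (h : 0 < t < rho) : is_derive t 1 U (- t * G t) by have [] := profile t h.
have dGP (t : R) (h : 0 < t < rho) : is_derive t 1 G (dG t) by have [] := profile t h.
have cdG (t : R) (h : 0 < t < rho) : {for t, continuous dG} by have [] := profile t h.
have [Cg Cg0 gC] := enorm_mulmx_le g; have [cg cg0 cgP] := enorm_mulmx_ge hg.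
(* On the ball of radius r the value of |g x| stays at most rho / 2, which keeps
   closed annuli inside the domain of the profile. *)
pose r := Num.min R0 (rho / (2 * Cg)).
have r0 : 0 < r by rewrite lt_min hR0 divr_gt0// mulr_gt0.
have sr x : enorm x < r -> s x <= rho / 2.
  move=> xr; apply: (le_trans (gC x)); rewrite mulrC -ler_pdivlMr//.
  apply: (le_trans (ltW xr)); rewrite /r ge_min; apply/orP; right.
  by rewrite invfM mulrA.
have rho2 : rho / 2 < rho by rewrite ltr_pdivrMr// ltr_pMr// ltr1n.
have srho x : punctured_eball r x -> 0 < s x < rho.
  rewrite punctured_eballE => /andP[x0 xr].
  by rewrite (lt_le_trans _ (cgP x)) ?mulr_gt0//= (le_lt_trans (sr x xr)).
exists (radial_fun g U); split; last exact: radial_fun_singular.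
have cu x (h : punctured_eball r x) : {for x, continuous (radial_fun g U)} :=
  radial_fun_continuous dU (srho x h).
have cdu i x (h : punctured_eball r x) : {for x, continuous (radial_fun1 g G i)} :=
  radial_fun1_continuous dGP (srho x h).
have cd2u i j x (h : punctured_eball r x) : {for x, continuous (radial_fun2 g G dG i j)} :=
  radial_fun2_continuous dGP cdG (srho x h).
have udu i x (h : punctured_eball r x) := radial_fun_derive dU i (srho x h).
have dud2u i j x (h : punctured_eball r x) := radial_fun1_derive dGP i j (srho x h).
have o_ball : open (punctured_eball r : set 'cV[R]_N).
  by rewrite punctured_eballE; exact: open_annulus.
exists r; split.
- by rewrite r0 /r ge_min lexx.
- move=> x xr; split; last exact: cu.
  by have [] := profile _ (srho x xr).
- move=> e /andP[e0 _].
  by apply: (radial_fun_sobolev hg dU dGP cdG _ e0 r0 rho2 sr); rewrite ltr0n.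
exists (radial_fun1 g G), (radial_fun2 g G dG); split.
- by move=> i; exact: (weak_deriv_first o_ball cu cdu udu).
- by move=> i j; exact: (weak_deriv_second o_ball cu cdu cd2u udu dud2u).
have [amin [C [amin0 C0 hcoef]]] := ae_coef_bounds hnu ha_ell hc hb_bound hg hR1_sub.
have h1 := ae_mulmx hg hcoef.
have h2 := ae_mulmx hg (le_env_ae (Psi g a b)).
have h3 := ae_mulmx hg (le_env_ae (Theta g a K)).
apply: filterS3 h1 h2 h3 => x; rewrite -/(s x) => h1 h2 h3 xr.
have sx := srho x xr; have /andP[s0 srh] := sx.
have sR1 : 0 < s x < R1 by rewrite s0 (lt_trans srh).
have [A0 _] : amin <= radial_coef g a (g *m x) /\ `|Psi g a b (g *m x)| <= C.
  by apply: h1; rewrite s0 ltW//; case/andP: sR1.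
have {A0} A0 : 0 < radial_coef g a (g *m x) by exact: lt_le_trans A0.
have [_ _ _ Ux Gx] := profile _ sx.
rewrite (elliptic_op_radial G dG b hg s0 (lt0r_neq0 A0)).
have Kx : K x = radial_coef g a (g *m x) * Theta g a K (g *m x).
  by rewrite /Theta mulmxA mulVmx// mul1mx mulrC divfK// gt_eqF.
have Psi_le : Psi g a b (g *m x) <= fine (env (Psi g a b) (s x)).
  have /andP[b1 b2] := PsiC _ sR1.
  rewrite -lee_fin fineK// fin_numElt.
  by rewrite (lt_le_trans _ b1) ?ltNyr// (le_lt_trans b2) ?ltry.
have Theta_le : Theta g a K (g *m x) <= fine (env (Theta g a K) (s x)).
  have s20 : 0 < s x / 2 by rewrite divr_gt0.
  have [M M0 TM] := T_bd _ s20.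
  rewrite -lee_fin fineK// fin_numElt (lt_le_trans _ (T_ge0 _ sR1)) ?ltNyr//=.
  rewrite (le_lt_trans (TM _ _)) ?ltry//; case/andP: sR1 => _ ->.
  by rewrite andbT ltr_pdivrMr// ltr_pMr// ltr1n.
(* After division by the positive coefficient, Theta and Psi are replaced by their
   envelopes, which increases the left side and decreases the right side. *)
rewrite Kx -mulrA ler_wpM2l ?(ltW A0)//.
apply: (@le_trans _ _ (fine (env (Theta g a K) (s x)) * U (s x) `^ p)).
  by rewrite ler_wpM2r ?powR_ge0.
apply: (le_trans (UP _ sx)).
by rewrite lerB// ler_wpM2l ?(ltW Gx).
Qed.
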